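(* Let $d\ge 1$ be a fixed integer. Then $$\lim_{n\to+\infty}\mathring\mu_n(d\mid d)_d=\frac1d,$$ where $n$ ranges over the integers $n\ge\max(2d,4)$.
   Context: $\mathbb{R}^n$ and $\Lambda^2(\mathbb{R}^n)$ carry their canonical Euclidean norms. **Rational subspaces.** A linear subspace $B$ of $\mathbb{R}^n$ is rational if it has a basis of vectors with rational coordinates; $\mathfrak{R}_n(e)$ is the set of rational subspaces of $\mathbb{R}^n$ of dimension $e$. **Height.** For $B\in\mathfrak{R}_n(e)$, the Plücker coordinates of $B$ are the $\binom{n}{e}$ minors of size $e\times e$ of an $n\times e$ matrix whose columns form a basis of $B$ (well defined up to a nonzero scalar); choosing a representative $\Xi$ with integer coordinates with gcd $1$, set $H(B)=\|\Xi\|$ (Euclidean norm). **Angles.** For nonzero $X,Y\in\mathbb{R}^n$ let $\psi(X,Y)=\|X\wedge Y\|/(\|X\|\,\|Y\|)$ (sine of the angle). For subspaces $A,B$ of dimensions $d,e\ge 1$ and $t=\min(d,e)$, define $\psi_1(A,B),\dots,\psi_t(A,B)$ recursively: $\psi_1(A,B)=\min\psi(X,Y)$ over $X\in A\setminus\{0\}$, $Y\in B\setminus\{0\}$, attained at unit vectors $X_1,Y_1$; given $(X_1,Y_1),\dots,(X_j,Y_j)$, $\psi_{j+1}(A,B)=\min\psi(X,Y)$ over nonzero $X\in A$ orthogonal to $X_1,\dots,X_j$ and nonzero $Y\in B$ orthogonal to $Y_1,\dots,Y_j$, attained at unit vectors $X_{j+1},Y_{j+1}$. (These numbers do not depend on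 the choices.) **Irrationality and exponents.** Let $d,e\in\{1,\dots,n-1\}$ with $d+e\le n$ and $1\le j\le\min(d,e)$. $\mathfrak{I}_n(d,e)_j$ is the set of $d$-dimensional subspaces $A$ of $\mathbb{R}^n$ with $\dim(A\cap B)<j$ for all $B\in\mathfrak{R}_n(e)$. For $A\in\mathfrak{I}_n(d,e)_j$, $\mu_n(A\mid e)_j\in(0,+\infty]$ is the supremum of the $\beta>0$ such that $\psi_j(A,B)\le H(B)^{-\beta}$ for infinitely many $B\in\mathfrak{R}_n(e)$. Finally $\mathring\mu_n(d\mid e)_j=\inf_{A\in\mathfrak{I}_n(d,e)_j}\mu_n(A\mid e)_j$. *)

(* Defs.v *)
(* MathComp-Analysis, over an arbitrary model R of the real numbers. *)
From HB Require Import structures.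
From mathcomp Require Export all_boot all_order all_algebra.
From mathcomp Require Export all_classical all_reals all_analysis.
Export Order.TTheory GRing.Theory Num.Theory numFieldNormedType.Exports.

#[export] Set Implicit Arguments.
#[export] Unset Strict Implicit.
#[export] Unset Printing Implicit Defensive.

Local Open Scope classical_set_scope.
Local Open Scope ring_scope.

Section Euclidean.
Context {R : realType} {n : nat}.
Implicit Types X Y : 'cV[R]_n.

Definition dot X Y : R := \sum_i X i 0 * Y i 0.

(* The norm that the library puts on matrices is the sup norm. *)
Definition enorm X : R := Num.sqrt (\sum_i X i 0 ^+ 2).

(* The norm of the bivector X /\ Y, from its coordinates in the orthonormal
   basis e_i /\ e_j (i < j). *)
Definition wedge_norm X Y : R :=
  Num.sqrt (\sum_(i < n) \sum_(j < n | (i < j)%N)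
              (X i 0 * Y j 0 - X j 0 * Y i 0) ^+ 2).

Definition sine X Y : R := wedge_norm X Y / (enorm X * enorm Y).

End Euclidean.

Section Rational.
Context {R : realType} {n : nat}.
Implicit Types B : {vspace 'cV[R]_n}.

Definition rational_vector (X : 'cV[R]_n) : Prop := forall i, rational (X i 0).

Definition rational_subspaces (e : nat) : set {vspace 'cV[R]_n} :=
  [set B | \dim B = e /\
    exists b : seq 'cV[R]_n,
      basis_of B b /\ (forall X, X \in b -> rational_vector X)].

(* The e-element subsets of 'I_n, which index the e x e minors, are represented
   by their increasing enumerations. *)
Definition increasing (e : nat) (I : {ffun 'I_e -> 'I_n}) : bool :=
  [forall i : 'I_e, forall j : 'I_e, (i < j)%N ==> (I i < I j)%N].

(* A family is indexed by all maps I, but only its values at the increasing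
   ones are coordinates; all other values are irrelevant. *)
Definition plucker_representative B
    (Xi : {ffun {ffun 'I_(\dim B) -> 'I_n} -> int}) : Prop :=
  (exists (M : 'M[R]_(n, \dim B)) (c : R),
     [/\ basis_of B [seq col j M | j <- enum 'I_(\dim B)], c != 0 &
         forall I, increasing I -> (Xi I)%:~R = c * \det (rowsub I M)]) /\
  (\big[gcdn/0%N]_(I | increasing I) `|Xi I|%N)%N = 1%N.

(* Meaningful for rational B only. A primitive representative is then unique up
   to sign, so that the choice made by xget is immaterial. *)
Definition height B : R :=
  let Xi := xget 0 [set Xi | @plucker_representative B Xi] in
  Num.sqrt (\sum_(I | increasing I) (Xi I)%:~R ^+ 2).

End Rational.

Section Angles.
Context {R : realType} {n : nat}.
Implicit Types A B : {vspace 'cV[R]_n}.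
Implicit Types s : seq ('cV[R]_n * 'cV[R]_n).

Definition admissible A B s (p : 'cV[R]_n * 'cV[R]_n) : Prop :=
  [/\ p.1 \in A, p.2 \in B, p.1 != 0, p.2 != 0 &
      forall q, q \in s -> dot q.1 p.1 = 0 /\ dot q.2 p.2 = 0].

(* The unit pairs at which the minimum of the sine over the pairs admissible
   for s is attained. *)
Definition minimizers A B s : set ('cV[R]_n * 'cV[R]_n) :=
  [set p | [/\ admissible A B s p, enorm p.1 = 1, enorm p.2 = 1 &
      forall q, admissible A B s q -> sine p.1 p.2 <= sine q.1 q.2]].

(* (X_1, Y_1), ..., (X_j, Y_j); for j <= min (\dim A) (\dim B) a minimizer
   exists at each step, and the default value of xget plays no role. *)
Fixpoint principal_pairs A B (j : nat) : seq ('cV[R]_n * 'cV[R]_n) :=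
  if j is k.+1 then
    let s := principal_pairs A B k in
    rcons s (xget (0, 0) (minimizers A B s))
  else [::].

(* psi_j(A, B), numbered from j = 1. *)
Definition psi (j : nat) A B : R :=
  let p := last (0, 0) (principal_pairs A B j) in sine p.1 p.2.

End Angles.

Section Exponents.
Context {R : realType} {n : nat}.

Definition irrational_subspaces (d e j : nat) : set {vspace 'cV[R]_n} :=
  [set A | \dim A = d /\
    forall B, rational_subspaces e B -> (\dim (A :&: B) < j)%N].

Definition mu (A : {vspace 'cV[R]_n}) (e j : nat) : \bar R :=
  ereal_sup [set beta%:E | beta in [set beta : R | 0 < beta /\
    infinite_set [set B | rational_subspaces e B /\
                          psi j A B <= height B `^ (- beta)]]].

End Exponents.

(* Used for 1 <= d, e <= n - 1, d + e <= n and 1 <= j <= min d e. *)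
Definition mu_ring (R : realType) (n d e j : nat) : \bar R :=
  ereal_inf [set mu A e j | A in @irrational_subspaces R n d e j].

(* Main.v *)
Require Import Defs.
From HB Require Import structures.
From mathcomp Require Import all_boot all_order all_algebra.
From mathcomp Require Import all_classical all_reals all_analysis.
From mathcomp Require Import perm ring lra zify.

Local Open Scope classical_set_scope.
Local Open Scope ring_scope.

(** The exponents are squeezed between 1/d and 1/d + 1/(n - d).

    Both bounds rest on the geometry of the principal vectors: they form
    orthonormal bases of A and of B with a diagonal matrix of dot products
    ([principal_vectors]). Hence psi_d, the largest of the sines, is at most
    delta as soon as every unit vector of A is within delta of B ([psi_le_dist]), and
    every unit vector of B is within psi_d of A ([dist_le_psi]).

    Lower bound ([mu_ge_inv]), valid for every A which is not itself rational. Write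
    A as the column span of a matrix G that contains an identity block. Rounding
    the entries of G to multiples of 1/q gives a rational subspace B_q with
    psi_d(A, B_q) = O(1/q), whose height is O(q^d) since its Pluecker coordinates
    are, up to a factor, the minors of an integer matrix of size O(q). Hence
    psi_d(A, B_q) <= H(B_q)^(-b) for every b < 1/d and all large q. As B_q tends
    to A without ever reaching it, infinitely many subspaces occur.

    Upper bound ([exists_mu_le]). Let n = d + m, and let f be an irreducible
    monic integer polynomial of degree n with n distinct real roots r_k
    ([trpoly_irreducible], [trpoly_roots]). The linear forms
    l_k(x) = x_0 + x_1 r_k + ... + x_(n-1) r_k^(n-1) are conjugate, so that
    |l_1(y) ... l_n(y)| >= 1 for every nonzero integer vector y, the product being
    a nonzero integral norm ([totally_real_forms]). Let A be the common kernel of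
    m of these forms. A rational subspace B of dimension d contains a nonzero
    integer vector y of norm O(H(B)^(1/d)) ([short_vector]). Its distance to A is
    at most psi_d(A, B) |y|, so the m forms vanishing on A are
    O(psi_d(A, B) |y|) at y, and the d others are O(|y|). Therefore
    1 <= C |y|^n psi_d(A, B)^m <= C' H(B)^(n/d) psi_d(A, B)^m. If moreover
    psi_d(A, B) <= H(B)^(-b) with b > n/(d m) = 1/d + 1/m, then H(B) is bounded,
    which leaves finitely many B ([finite_height_le]). *)

(** * Dot product and sine *)

Section Dot.
Context {R : realType} {n : nat}.
Implicit Types X Y Z : 'cV[R]_n.

Lemma dotC X Y : dot X Y = dot Y X.
Proof. by apply: eq_bigr => i _; rewrite mulrC. Qed.

Lemma dot_linear X : linear (dot X : 'cV[R]_n -> R^o).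
Proof.
move=> a Y Z; rewrite /dot scaler_sumr -big_split; apply: eq_bigr => i _ /=.
by rewrite !mxE -[a *: _]/(a * _); ring.
Qed.

HB.instance Definition _ X :=
  GRing.isLinear.Build R 'cV[R]_n R^o _ (dot X) (dot_linear X).

Lemma dot0 X : dot X 0 = 0. Proof. exact: linear0. Qed.
Lemma dotDr X Y Z : dot X (Y + Z) = dot X Y + dot X Z. Proof. exact: linearD. Qed.
Lemma dotNr X Y : dot X (- Y) = - dot X Y. Proof. exact: linearN. Qed.
Lemma dotZr a X Y : dot X (a *: Y) = a * dot X Y. Proof. exact: linearZ. Qed.
Lemma dotDl X Y Z : dot (X + Y) Z = dot X Z + dot Y Z.
Proof. by rewrite !(dotC _ Z) dotDr. Qed.
Lemma dotNl X Y : dot (- X) Y = - dot X Y.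
Proof. by rewrite !(dotC _ Y) dotNr. Qed.
Lemma dotZl a X Y : dot (a *: X) Y = a * dot X Y.
Proof. by rewrite !(dotC _ Y) dotZr. Qed.
Lemma dot_sumr I (r : seq I) (F : I -> 'cV[R]_n) X :
  dot X (\sum_(i <- r) F i) = \sum_(i <- r) dot X (F i).
Proof. exact: linear_sum. Qed.
Lemma dot_suml I (r : seq I) (F : I -> 'cV[R]_n) X :
  dot (\sum_(i <- r) F i) X = \sum_(i <- r) dot (F i) X.
Proof. by rewrite dotC dot_sumr; apply: eq_bigr => i _; rewrite dotC. Qed.

Definition dotE := (dotDl, dotDr, dotNl, dotNr, dotZl, dotZr).

Lemma enormE X : enorm X = Num.sqrt (dot X X).
Proof. by congr Num.sqrt; apply: eq_bigr => i _; rewrite expr2. Qed.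

Lemma dot_ge0 X : 0 <= dot X X.
Proof. by apply: sumr_ge0 => i _; rewrite -expr2 sqr_ge0. Qed.

Lemma dot_eq0 X : (dot X X == 0) = (X == 0).
Proof.
apply/eqP/eqP => [|->]; last exact: dot0.
move=> /eqP; rewrite psumr_eq0 => [/allP h|i _]; last by rewrite -expr2 sqr_ge0.
apply/colP => i; apply/eqP; rewrite mxE.
by have := h i (mem_index_enum _); rewrite /= mulf_eq0 orbb.
Qed.

Lemma dot_gt0 X : (0 < dot X X) = (X != 0).
Proof. by rewrite lt_def dot_eq0 dot_ge0 andbT. Qed.

Lemma enorm_eq1 X : (enorm X = 1) <-> (dot X X = 1).
Proof.
rewrite enormE; split => [h|->]; last by rewrite sqrtr1.
by rewrite -[LHS](sqr_sqrtr (dot_ge0 X)) h expr1n.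
Qed.

Lemma unit_neq0 X : dot X X = 1 -> X != 0.
Proof. by rewrite -dot_gt0 => ->. Qed.

(** Lagrange's identity: the sum over all ordered pairs of indices counts each
    coordinate of the bivector twice and vanishes on the diagonal. *)
Lemma wedge_norm_Lagrange X Y :
  \sum_(i < n) \sum_(j < n | (i < j)%N) (X i 0 * Y j 0 - X j 0 * Y i 0) ^+ 2
  = dot X X * dot Y Y - dot X Y ^+ 2.
Proof.
pose F (i j : 'I_n) := (X i 0 * Y j 0 - X j 0 * Y i 0) ^+ 2.
have dbl : \sum_(i < n) \sum_(j < n) F i j =
    2 * \sum_(i < n) \sum_(j < n | (i < j)%N) F i j.
  have -> : \sum_(i < n) \sum_(j < n) F i j =
      \sum_(i < n) (\sum_(j < n | (i < j)%N) F i j) +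
      \sum_(i < n) (\sum_(j < n | (j < i)%N) F i j).
    rewrite -big_split; apply: eq_bigr => i _ /=.
    rewrite (bigID (fun j : 'I_n => (i < j)%N)) /=; congr (_ + _).
    rewrite (bigD1 i) ?ltnn//= {1}/F subrr expr0n add0r.
    by apply: eq_bigl => j; rewrite -leqNgt ltn_neqAle andbC.
  rewrite mulr2n mulrDl mul1r; congr (_ + _).
  rewrite (exchange_big_dep xpredT)//=; apply: eq_bigr => j _.
  by apply: eq_bigr => i _; rewrite /F; ring.
have all : \sum_(i < n) \sum_(j < n) F i j = 2 * (dot X X * dot Y Y - dot X Y ^+ 2).
  have -> : \sum_(i < n) \sum_(j < n) F i j = \sum_(i < n) \sum_(j < n)
      (X i 0 * X i 0 * (Y j 0 * Y j 0) + Y i 0 * Y i 0 * (X j 0 * X j 0)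
       - 2 * ((X i 0 * Y i 0) * (X j 0 * Y j 0))).
    by apply: eq_bigr => i _; apply: eq_bigr => j _; rewrite /F; ring.
  transitivity (dot X X * dot Y Y + dot Y Y * dot X X
                - 2 * (dot X Y * dot X Y)); last by ring.
  rewrite /dot !big_distrlr /= -big_split mulr_sumr -sumrB /=.
  apply: eq_bigr => i _.
  by rewrite mulr_sumr -big_split -sumrB /=.
have two : (2 : R) != 0 by rewrite pnatr_eq0.
by apply: (mulfI two); rewrite -dbl all.
Qed.

Lemma dot_CauchySchwarz X Y : dot X Y ^+ 2 <= dot X X * dot Y Y.
Proof.
rewrite -subr_ge0 -wedge_norm_Lagrange.
by do 2!(apply: sumr_ge0 => ? _); rewrite sqr_ge0.
Qed.

Lemma sine_sqr X Y :
  sine X Y ^+ 2 = (dot X X * dot Y Y - dot X Y ^+ 2) / (dot X X * dot Y Y).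
Proof.
rewrite /sine /wedge_norm wedge_norm_Lagrange !enormE exprMn exprVn exprMn.
by rewrite !sqr_sqrtr ?dot_ge0// subr_ge0 dot_CauchySchwarz.
Qed.

Lemma sine_ge0 X Y : 0 <= sine X Y.
Proof. by rewrite divr_ge0 ?mulr_ge0 ?sqrtr_ge0. Qed.

Lemma sine_unit X Y : dot X X = 1 -> dot Y Y = 1 ->
  sine X Y ^+ 2 = 1 - dot X Y ^+ 2.
Proof. by move=> hX hY; rewrite sine_sqr hX hY !mulr1 divr1. Qed.

Lemma ler_sine X Y X' Y' :
  (sine X Y <= sine X' Y') = (sine X Y ^+ 2 <= sine X' Y' ^+ 2).
Proof. by rewrite ler_sqr ?nnegrE ?sine_ge0. Qed.

Lemma sineZ a b X Y : a != 0 -> b != 0 -> sine (a *: X) (b *: Y) = sine X Y.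
Proof.
move=> a0 b0; have [X0|X0] := eqVneq X 0.
  have -> : a *: X = X by rewrite X0 scaler0.
  by rewrite /sine enormE X0 dot0 sqrtr0 !mul0r !invr0 !mulr0.
have [Y0|Y0] := eqVneq Y 0.
  have -> : b *: Y = Y by rewrite Y0 scaler0.
  by rewrite /sine (enormE Y) Y0 dot0 sqrtr0 !mulr0 !invr0 !mulr0.
apply/eqP; rewrite -(eqrXn2 (n:=2))// ?sine_ge0// !sine_sqr !dotE.
move: X0 Y0; rewrite -!dot_eq0 => X0 Y0; apply/eqP; field.
by rewrite a0 b0 X0 Y0.
Qed.

Lemma normalized X : X != 0 ->
  exists a, a != 0 /\ dot (a *: X) (a *: X) = 1.
Proof.
rewrite -dot_gt0 => X0; exists (Num.sqrt (dot X X))^-1.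
have s0 : Num.sqrt (dot X X) != 0 by rewrite gt_eqF ?sqrtr_gt0.
split; first by rewrite invr_eq0.
by rewrite !dotE -{3}(sqr_sqrtr (ltW X0)); field.
Qed.

End Dot.

(** * Principal vectors *)

Section Minimizers.
Context {R : realType} {n : nat}.
Implicit Types A B : {vspace 'cV[R]_n}.
Implicit Types X Y Z : 'cV[R]_n.

(** The orthogonality conditions are the kernel of a linear map to a space of
    dimension less than that of A. *)
Lemma exists_orthogonal A (s : seq 'cV[R]_n) : (size s < \dim A)%N ->
  exists X, [/\ X \in A, X != 0 & forall q, q \in s -> dot q X = 0].
Proof.
move=> sA; pose M : 'M[R]_(size s, n) := \matrix_(i, j) (nth 0 s i) j 0.
pose f : 'Hom('cV[R]_n, 'cV[R]_(size s)) := linfun (mulmx M).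
have fE X i : f X i 0 = dot (nth 0 s i) X.
  by rewrite lfunE mxE; apply: eq_bigr => j _; rewrite mxE.
have A0 : (A :&: lker f)%VS != 0%VS.
  apply: contraTneq sA => A0; rewrite -leqNgt -(limg_ker_dim f A) A0 dimv0 add0n.
  by rewrite (leq_trans (dimvS (subvf _)))// dimvf /dim/= muln1.
have := memv_pick (A :&: lker f)%VS; rewrite memv_cap => /andP[XA].
rewrite memv_ker => /eqP fX; exists (vpick (A :&: lker f)%VS); split => //.
  by rewrite vpick0.
move=> q qs; have iq : (index q s < size s)%N by rewrite index_mem.
by have := fE (vpick (A :&: lker f)%VS) (Ordinal iq); rewrite fX mxE nth_index.
Qed.

(** Membership in A as finitely many linear equations, which are closed
    conditions. *)
Lemma memv_dot A : exists u : 'I_n -> 'cV[R]_n,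
  forall X, X \in A <-> forall i, dot (u i) X = 0.
Proof.
pose v j : 'cV[R]_n := delta_mx j 0 - projv A (delta_mx j 0).
exists (fun i => \col_j v j i 0) => X.
have uE i : dot (\col_j v j i 0) X = (X - projv A X) i 0.
  rewrite {2 3}[X]matrix_sum_delta (eq_bigr (fun j => X j 0 *: delta_mx j 0)).
    rewrite linear_sum -sumrB summxE; apply: eq_bigr => j _.
    by rewrite mxE linearZ -scalerBr [in RHS]mxE mulrC.
  by move=> j _; rewrite big_ord1.
split => [XA i|h]; first by rewrite uE projv_id// subrr mxE.
have /eqP : X - projv A X = 0 by apply/colP => i; rewrite -uE h mxE.
by rewrite subr_eq0 => /eqP ->; exact: memv_proj.
Qed.

Lemma dot_continuous {T : topologicalType} (f g : T -> 'cV[R]_n) :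
  (forall i, continuous (fun z => f z i 0)) ->
  (forall i, continuous (fun z => g z i 0)) ->
  continuous (fun z => dot (f z) (g z) : R).
Proof.
move=> cf cg; apply: continuous_big => [|i _ z]; first exact: add_continuous.
by apply: cvgM; [exact: cf|exact: cg].
Qed.

Lemma closed_level {T : topologicalType} (f : T -> R) (c : R) :
  continuous f -> closed [set z | f z = c].
Proof.
move=> cf; have -> : [set z | f z = c] = f @^-1` [set x | x = c] by [].
by apply: closed_comp; [move=> z _; exact: cf|exact: closed_eq].
Qed.

(** The sine of a pair of unit vectors is smallest where the square of their
    dot product is largest, and the admissible pairs of unit vectors form a
    compact set. *)
Lemma exists_minimizer A B (s : seq ('cV[R]_n * 'cV[R]_n)) :
  (size s < \dim A)%N -> (size s < \dim B)%N -> exists p, minimizers A B s p.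
Proof.
move=> sA sB.
have [X0 [X0A X00 X0s]] := @exists_orthogonal A [seq q.1 | q <- s]
   ltac:(by rewrite size_map).
have [Y0 [Y0B Y00 Y0s]] := @exists_orthogonal B [seq q.2 | q <- s]
   ltac:(by rewrite size_map).
have [u uA] := memv_dot A; have [v vB] := memv_dot B.
pose fX (z : 'rV[R]_(n + n)) := (lsubmx z)^T.
pose fY (z : 'rV[R]_(n + n)) := (rsubmx z)^T.
have cX i : continuous (fun z => fX z i 0).
  have -> : (fun z => fX z i 0) = (fun z : 'rV[R]_(n + n) => z 0 (lshift n i)).
    by apply/funext => z; rewrite !mxE.
  exact: coord_continuous.
have cY i : continuous (fun z => fY z i 0).
  have -> : (fun z => fY z i 0) = (fun z : 'rV[R]_(n + n) => z 0 (rshift n i)).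
    by apply/funext => z; rewrite !mxE.
  exact: coord_continuous.
have cc (W : 'cV[R]_n) i : continuous (fun z : 'rV[R]_(n + n) => W i 0).
  exact: cst_continuous.
pose K := [set z | [/\ fX z \in A, fY z \in B, dot (fX z) (fX z) = 1,
    dot (fY z) (fY z) = 1 &
    forall q, q \in s -> dot q.1 (fX z) = 0 /\ dot q.2 (fY z) = 0]].
have clK : closed K.
  have -> : K = (\bigcap_i [set z | dot (u i) (fX z) = 0]) `&`
      (\bigcap_i [set z | dot (v i) (fY z) = 0]) `&`
      [set z | dot (fX z) (fX z) = 1] `&` [set z | dot (fY z) (fY z) = 1] `&`
      (\bigcap_(q in [set` s]) [set z | dot q.1 (fX z) = 0]) `&`
      (\bigcap_(q in [set` s]) [set z | dot q.2 (fY z) = 0]).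
    apply/seteqP; split => z; rewrite /K /=.
      move=> [/uA zA /vB zB z1 z2 zs]; split; last by move=> q /zs[].
      split; last by move=> q /zs[].
      by split => //; split => //; split => [i _|i _]; [exact: zA|exact: zB].
    move=> [[[[[h1 h2] h3] h4] h5] h6]; split => //.
    - by apply/uA => i; apply: h1.
    - by apply/vB => i; apply: h2.
    - by move=> q qs; split; [exact: h5|exact: h6].
  by do !apply: closedI; (try apply: closed_bigI => ? _);
     apply: closed_level; apply: dot_continuous.
have bK : bounded_set K.
  exists 1; split => // M M1 z [_ _ z1 z2 _].
  have le1 (W : 'cV[R]_n) i : dot W W = 1 -> `|W i 0| <= 1.
    move=> W1; rewrite -(expr_le1 (n:=2))// real_normK ?num_real// -W1 /dot.
    by rewrite (bigD1 i)//= expr2 lerDl sumr_ge0// => j _; rewrite -expr2 sqr_ge0.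
  apply: le_trans (ltW M1); rewrite [leLHS]mx_normrE.
  apply/bigmax_leP; split => // -[i j] _ /=; rewrite ord1 -[z]hsubmxK.
  case: (fintype.splitP j) => k kE.
    have -> : j = lshift n k by apply/val_inj.
    by rewrite row_mxEl; have := le1 _ k z1; rewrite mxE.
  have -> : j = rshift n k by apply/val_inj.
  by rewrite row_mxEr; have := le1 _ k z2; rewrite mxE.
have pairK X Y a b : admissible A B s (X, Y) -> dot (a *: X) (a *: X) = 1 ->
   dot (b *: Y) (b *: Y) = 1 -> K (row_mx (a *: X)^T (b *: Y)^T).
  move=> [/= XA YB _ _ h] a1 b1; rewrite /K /= /fX /fY row_mxKl row_mxKr !trmxK.
  split; rewrite ?memvZ// => q /h[h1 h2]; by rewrite !dotZr h1 h2 !mulr0.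
have K0 : K !=set0.
  have [a [_ a1]] := normalized X00; have [b [_ b1]] := normalized Y00.
  eexists; apply: (pairK X0 Y0 a b) => //; split => //= q qs.
  by split; [apply: X0s|apply: Y0s]; apply/mapP; exists q.
have cf : continuous (fun z => - (dot (fX z) (fY z) * dot (fX z) (fY z)) : R).
  move=> z; have h := dot_continuous cX cY.
  exact: (cvgN (cvgM (h z) (h z))).
have [c] := compact_EVT_min K0 (bounded_closed_compact bK clK)
   (continuous_subspaceT cf).
rewrite inE => -[cA cB c1 c2 cs] cmin; exists (fX c, fY c); split => /=.
- by split; rewrite ?unit_neq0.
- exact/enorm_eq1.
- exact/enorm_eq1.
move=> [X Y] adm; case: (adm) => /= XA YB XN YN _.
have [a [a0 a1]] := normalized XN; have [b [b0 b1]] := normalized YN.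
rewrite -(sineZ X Y a0 b0) ler_sine !sine_unit// lerB// -lerN2.
have := cmin _ (mem_set (pairK _ _ _ _ adm a1 b1)).
by rewrite /fX /fY row_mxKl row_mxKr !trmxK -!expr2.
Qed.

End Minimizers.

Section Principal.
Context {R : realType} {n : nat}.
Implicit Types A B : {vspace 'cV[R]_n}.
Implicit Types X Y Z : 'cV[R]_n.

Lemma orthonormal_expansion B d (Y : 'I_d -> 'cV[R]_n) : \dim B = d ->
  (forall i, Y i \in B) -> (forall i j, dot (Y i) (Y j) = (i == j)%:R) ->
  forall Z, Z \in B -> exists c : 'I_d -> R, Z = \sum_i c i *: Y i.
Proof.
move=> dB YB Yo Z ZB; pose s := [tuple Y i | i < d].
have sY (i : 'I_d) : s`_i = Y i by rewrite (nth_map i) ?size_enum_ord// nth_ord_enum.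
have fs : free s.
  apply/freeP => k k0 i; have := congr1 (dot (Y i)) k0.
  rewrite dot0 dot_sumr (bigD1 i)//= dotZr sY Yo eqxx mulr1 big1 ?addr0// => j ji.
  by rewrite dotZr sY Yo eq_sym (negPf ji) mulr0.
have sB : (span s <= B)%VS by apply/span_subvP => _ /mapP[i _ ->]; exact: YB.
have bs : basis_of B s.
  rewrite /basis_of fs andbT eqEdim sB dB.
  by move: fs; rewrite /free size_tuple => /eqP->/=.
exists (fun i => coord s i Z); rewrite {1}(coord_basis bs ZB).
by apply: eq_bigr => i _; rewrite sY.
Qed.

(** If Y realizes the maximum of (X . Y)^2 among the unit vectors of the plane
    spanned by the orthonormal vectors Y and Z, then X is orthogonal to Z: the
    unit vector of that plane in the direction of the projection of X would
    otherwise do better. *)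
Lemma first_variation X Y Z : dot X X = 1 -> dot Y Y = 1 -> dot Z Z = 1 ->
  dot Y Z = 0 ->
  (forall a b, a ^+ 2 + b ^+ 2 = 1 ->
     sine X Y <= sine X (a *: Y + b *: Z)) -> dot X Z = 0.
Proof.
move=> X1 Y1 Z1 YZ hmin; have [//|XZ] := eqVneq (dot X Z) 0.
pose s := dot X Y ^+ 2 + dot X Z ^+ 2; exfalso.
have s0 : 0 < s by rewrite ltr_wpDl ?sqr_ge0// exprn_even_gt0//= XZ.
pose r := Num.sqrt s; have r0 : r != 0 by rewrite gt_eqF// sqrtr_gt0.
have rs : r ^+ 2 = s by rewrite sqr_sqrtr// ltW.
have ab1 : (dot X Y / r) ^+ 2 + (dot X Z / r) ^+ 2 = 1.
  by rewrite !exprMn -mulrDl exprVn rs divff// gt_eqF.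
have := hmin _ _ ab1; rewrite ler_sine !sine_unit//; last first.
  by rewrite !dotE Y1 Z1 (dotC Z Y) YZ -[RHS]ab1; ring.
rewrite lerD2l lerN2; have -> : dot X (dot X Y / r *: Y + dot X Z / r *: Z) = r.
  transitivity (s / r); first by rewrite !dotE /s; field.
  by rewrite -rs; field.
by rewrite rs /s gerDl leNgt exprn_even_gt0//= XZ.
Qed.

Lemma principal_pairsE A B k : principal_pairs A B k =
  [seq xget (0, 0) (minimizers A B (principal_pairs A B i)) | i <- iota 0 k].
Proof.
have iotaSr m : iota 0 m.+1 = rcons (iota 0 m) m by rewrite -cats1 -addn1 iotaD.
by elim: k => // k IH; rewrite iotaSr map_rcons -IH.
Qed.

(** Each pair minimizes the sine among the pairs orthogonal to the earlier ones,
    in particular when one of its members is rotated towards a later principal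
    vector; by the first variation, X_i and Y_j are thus orthogonal for i <> j.
    The last sine is the largest one because the sets of admissible pairs
    decrease. *)
Lemma principal_vectors A B d : \dim A = d.+1 -> \dim B = d.+1 ->
  exists X Y : 'I_d.+1 -> 'cV[R]_n,
  [/\ (forall i, X i \in A) /\ (forall i, Y i \in B),
     forall i j, dot (X i) (X j) = (i == j)%:R,
     forall i j, dot (Y i) (Y j) = (i == j)%:R,
     forall i j, i != j -> dot (X i) (Y j) = 0 &
     psi d.+1 A B ^+ 2 = 1 - dot (X ord_max) (Y ord_max) ^+ 2 /\
     forall i, 1 - dot (X i) (Y i) ^+ 2 <= psi d.+1 A B ^+ 2].
Proof.
move=> dA dB; pose P k := xget (0, 0) (minimizers A B (principal_pairs A B k)).
have PE k : principal_pairs A B k = [seq P i | i <- iota 0 k].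
  exact: principal_pairsE.
have Pmin (k : 'I_d.+1) : minimizers A B (principal_pairs A B k) (P k).
  by apply: xgetPex; apply: exists_minimizer;
    rewrite PE size_map size_iota ?dA ?dB.
have Pin i k : (i < k)%N -> P i \in principal_pairs A B k.
  by move=> ik; rewrite PE map_f// mem_iota.
pose X (i : 'I_d.+1) := (P i).1; pose Y (i : 'I_d.+1) := (P i).2.
have XA i : X i \in A by have [[]] := Pmin i.
have YB i : Y i \in B by have [[]] := Pmin i.
have X1 i : dot (X i) (X i) = 1 by apply/enorm_eq1; have [] := Pmin i.
have Y1 i : dot (Y i) (Y i) = 1 by apply/enorm_eq1; have [] := Pmin i.
have Xo i j : dot (X i) (X j) = (i == j)%:R.
  have [->|ij] := eqVneq i j; first exact: X1.
  have lt (k l : 'I_d.+1) : (k < l)%N -> dot (X k) (X l) = 0.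
    by move=> kl; have [[_ _ _ _ h] _ _ _] := Pmin l; have [] := h _ (Pin _ _ kl).
  by move: ij; rewrite neq_ltn => /orP[/lt//|/lt h]; rewrite dotC h.
have Yo i j : dot (Y i) (Y j) = (i == j)%:R.
  have [->|ij] := eqVneq i j; first exact: Y1.
  have lt (k l : 'I_d.+1) : (k < l)%N -> dot (Y k) (Y l) = 0.
    by move=> kl; have [[_ _ _ _ h] _ _ _] := Pmin l; have [] := h _ (Pin _ _ kl).
  by move: ij; rewrite neq_ltn => /orP[/lt//|/lt h]; rewrite dotC h.
have minP (k : 'I_d.+1) U V : U \in A -> V \in B -> dot U U = 1 -> dot V V = 1 ->
    (forall l : 'I_d.+1, (l < k)%N -> dot (X l) U = 0 /\ dot (Y l) V = 0) ->
    sine (X k) (Y k) <= sine U V.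
  move=> UA VB U1 V1 h; have [_ _ _ h'] := Pmin k.
  apply: (h' (U, V)); split => //=.
  - exact: unit_neq0.
  - exact: unit_neq0.
  rewrite PE => q /mapP[l]; rewrite mem_iota add0n => /andP[_ lk] ->.
  exact: (h (Ordinal (ltn_trans lk (ltn_ord k)))).
have ne (l k : 'I_d.+1) : (l < k)%N -> (l == k) = false.
  by move=> lk; apply/eqP => lk'; rewrite lk' ltnn in lk.
have XY_lt (k j : 'I_d.+1) : (k < j)%N -> dot (X k) (Y j) = 0.
  move=> kj; apply: (first_variation (Y := Y k)) => //.
    by rewrite Yo ne.
  move=> a b ab; apply: minP => //; first by rewrite memvD ?memvZ.
    by rewrite !dotE !Yo !eqxx (eq_sym j) ne//= -[RHS]ab; ring.
  move=> l lk; rewrite !dotE Xo !Yo !ne//; last exact: ltn_trans kj.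
  by rewrite !mulr0 addr0.
have sineC (U V : 'cV[R]_n) : sine U V = sine V U.
  apply/eqP; rewrite -(eqrXn2 (n := 2))// ?sine_ge0// !sine_sqr (dotC U V).
  by rewrite (mulrC (dot U U)).
have YX_lt (k j : 'I_d.+1) : (k < j)%N -> dot (Y k) (X j) = 0.
  move=> kj; apply: (first_variation (Y := X k)) => //.
    by rewrite Xo ne.
  move=> a b ab; rewrite !(sineC (Y k) _); apply: minP => //.
    by rewrite memvD ?memvZ.
    by rewrite !dotE !Xo !eqxx (eq_sym j) ne//= -[RHS]ab; ring.
  move=> l lk; rewrite !dotE Yo !Xo !ne//; last exact: ltn_trans kj.
  by rewrite !mulr0 addr0.
have psiE : psi d.+1 A B = sine (X ord_max) (Y ord_max).
  by rewrite /psi /= last_rcons.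
exists X, Y; split => //.
  move=> i j; rewrite neq_ltn => /orP[/XY_lt//|/YX_lt]; by rewrite dotC.
rewrite psiE sine_unit//; split => // i.
rewrite -!sine_unit// -ler_sine; apply: minP => // l li.
have lm : (l < d)%N by rewrite (leq_trans li)// -ltnS.
by rewrite Xo Yo ne.
Qed.

Lemma psi_ge0 j A B : 0 <= psi j A B.
Proof. exact: sine_ge0. Qed.

(** Since the last principal vector X_d of A is orthogonal to Y_1, ..., Y_(d-1),
    its distance to B is exactly psi_d. *)
Lemma psi_le_dist A B d delta : (0 < d)%N -> \dim A = d -> \dim B = d -> 0 <= delta ->
  (forall X, X \in A -> exists2 Y, Y \in B &
     dot (X - Y) (X - Y) <= delta ^+ 2 * dot X X) ->
  psi d A B <= delta.
Proof.
case: d => // d _ dA dB delta0 h.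
have [X [Y [[XA YB] Xo Yo XY [psiE _]]]] := principal_vectors dA dB.
have [Z ZB] := h _ (XA ord_max); rewrite Xo eqxx mulr1 => dXZ.
rewrite -ler_sqr ?nnegrE ?psi_ge0//; apply: le_trans dXZ; rewrite psiE.
have [c ZE] := orthonormal_expansion dB YB Yo ZB.
have XZ : dot (X ord_max) Z = c ord_max * dot (X ord_max) (Y ord_max).
  rewrite ZE dot_sumr (bigD1 ord_max)//= dotZr big1 ?addr0// => i im.
  by rewrite dotZr XY ?mulr0// eq_sym.
have ZZ : c ord_max ^+ 2 <= dot Z Z.
  have cE i : dot (Y i) Z = c i.
    rewrite ZE dot_sumr (bigD1 i)//= dotZr Yo eqxx mulr1 big1 ?addr0// => j ji.
    by rewrite dotZr Yo eq_sym (negPf ji) mulr0.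
  by have := dot_CauchySchwarz (Y ord_max) Z; rewrite Yo eqxx mul1r cE.
rewrite !dotE Xo eqxx (dotC Z (X _)) XZ /=.
have := sqr_ge0 (c ord_max - dot (X ord_max) (Y ord_max)); move: ZZ.
move: (c ord_max) (dot _ (Y _)) (dot Z Z) => a t z; nra.
Qed.

(** For Y = c_1 Y_1 + ... + c_d Y_d take X = c_1 t_1 X_1 + ... + c_d t_d X_d,
    where t_i = X_i . Y_i: the vectors Y_i - t_i X_i are pairwise orthogonal and
    have norms psi_i <= psi_d. *)
Lemma dist_le_psi A B d Y : (0 < d)%N -> \dim A = d -> \dim B = d -> Y \in B ->
  exists2 X, X \in A & dot (Y - X) (Y - X) <= psi d A B ^+ 2 * dot Y Y.
Proof.
case: d => // d _ dA dB yB.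
have [X [Z [[XA ZB] Xo Zo XZ [_ psimax]]]] := principal_vectors dA dB.
have [c YE] := orthonormal_expansion dB ZB Zo yB.
pose t i := dot (X i) (Z i).
exists (\sum_i c i *: (t i *: X i)); first by apply: memv_suml => i _; rewrite !memvZ.
have -> : Y - \sum_i c i *: (t i *: X i) = \sum_i c i *: (Z i - t i *: X i).
  by rewrite YE -sumrB; apply: eq_bigr => i _; rewrite scalerBr.
have diag (F : 'I_d.+1 -> 'cV[R]_n) : (forall i j, i != j -> dot (F i) (F j) = 0) ->
    dot (\sum_i c i *: F i) (\sum_i c i *: F i) = \sum_i c i ^+ 2 * dot (F i) (F i).
  move=> Fo; rewrite dot_suml; apply: eq_bigr => i _.
  rewrite dot_sumr (bigD1 i)//= big1 ?addr0 => [|j ji]; first by rewrite !dotE; ring.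
  by rewrite !dotE Fo ?mulr0// eq_sym.
rewrite diag; last first.
  move=> i j ij; rewrite !dotE Zo Xo (negPf ij) (dotC (Z i) (X j)) !XZ //= 1?eq_sym//.
  by ring.
rewrite YE diag => [|i j ij]; last by rewrite Zo (negPf ij).
rewrite mulr_sumr; apply: ler_sum => i _; rewrite Zo eqxx mulr1 mulrC.
rewrite ler_wpM2r ?sqr_ge0//; apply: le_trans (psimax i).
rewrite !dotE Zo Xo eqxx (dotC (Z i) (X i)) -/(t i).
by rewrite le_eqVlt; apply/orP; left; apply/eqP => /=; ring.
Qed.

End Principal.

(** * Column spans *)

Section Colspan.
Context {R : realType} {n d : nat}.
Implicit Types M : 'M[R]_(n, d).

Definition colspan M : {vspace 'cV[R]_n} := span [seq col j M | j <- enum 'I_d].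

Lemma mulmx_colE M x : M *m x = \sum_j x j 0 *: col j M.
Proof.
apply/colP => i; rewrite mxE summxE; apply: eq_bigr => j _.
by rewrite !mxE mulrC.
Qed.

Lemma colspanP M X : reflect (exists x, X = M *m x) (X \in colspan M).
Proof.
apply: (iffP idP) => [|[x ->]]; last first.
  rewrite mulmx_colE; apply: memv_suml => j _; apply/memvZ/memv_span.
  by apply: map_f; rewrite mem_enum.
move=> XM; have /coord_span XE : X \in span [tuple col j M | j < d] by [].
exists (\col_j coord [tuple col j M | j < d] j X).
rewrite mulmx_colE {1}XE; apply: eq_bigr => j _; rewrite mxE; congr (_ *: _).
by rewrite -tnth_nth tnth_mktuple.
Qed.

Lemma colspan_basis M : (forall x : 'cV[R]_d, M *m x = 0 -> x = 0) ->
  basis_of (colspan M) [seq col j M | j <- enum 'I_d].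
Proof.
move=> inj; rewrite /basis_of eqxx/=.
pose s := [tuple col j M | j < d].
have -> : [seq col j M | j <- enum 'I_d] = s by [].
apply/freeP => k k0 i.
suff /colP/(_ i) : \col_j k j = 0 :> 'cV[R]_d by rewrite !mxE.
apply: inj; rewrite mulmx_colE -[RHS]k0; apply: eq_bigr => j _.
by rewrite mxE -tnth_nth tnth_mktuple.
Qed.

Lemma dim_colspan M : (forall x : 'cV[R]_d, M *m x = 0 -> x = 0) ->
  \dim (colspan M) = d.
Proof.
by move=> /colspan_basis/size_basis ->; rewrite card_ord.
Qed.

Lemma dim_colspan_le M : (\dim (colspan M) <= d)%N.
Proof. by rewrite (leq_trans (dim_span _))// size_map size_enum_ord. Qed.

Lemma basis_colspan B M : basis_of B [seq col j M | j <- enum 'I_d] ->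
  B = colspan M /\ forall x : 'cV[R]_d, M *m x = 0 -> x = 0.
Proof.
move=> /andP[/eqP <- fr]; split => // x; rewrite mulmx_colE => x0.
pose s := [tuple col j M | j < d].
have /freeP fr' : free s by [].
apply/colP => i; rewrite mxE; apply: (fr' (fun j => x j 0)).
rewrite -[RHS]x0; apply: eq_bigr => j _.
by rewrite -tnth_nth tnth_mktuple.
Qed.

End Colspan.

Lemma colspan_sub {R : realType} {n d e : nat} (M : 'M[R]_(n, d)) (P : 'M[R]_(d, e)) :
  (colspan (M *m P) <= colspan M)%VS.
Proof.
apply/subvP => X /colspanP[x ->]; apply/colspanP; exists (P *m x).
by rewrite mulmxA.
Qed.

(** * Minors *)

Section Minors.
Context {n d : nat}.
Implicit Types f : {ffun 'I_d -> 'I_n}.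

(** The values of an injective map, listed in increasing order, form an
    increasing map, which differs from it by a permutation of the rows. *)
Lemma minor_sort f :
  (forall (T : comNzRingType) (W : 'M[T]_(n, d)), \det (rowsub f W) = 0) \/
  exists I (b : bool), increasing I /\
    forall (T : comNzRingType) (W : 'M[T]_(n, d)),
      \det (rowsub f W) = (-1) ^+ b * \det (rowsub I W).
Proof.
have [fi|] := boolP (injectiveb f); last first.
  move=> /injectivePn[i [j ij fij]]; left => T W.
  apply: (determinant_alternate ij) => k; by rewrite !mxE fij.
move/injectiveP in fi; right.
have cA : #|f @: 'I_d| = d by rewrite card_imset// card_ord.
pose s := enum (f @: 'I_d).
have sz : size s = d by rewrite -cardE.
pose g := [ffun i : 'I_d => nth (f i) s i].
have gE (x0 : 'I_n) i : g i = nth x0 s i.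
  by rewrite ffunE; apply: set_nth_default; rewrite sz.
have sord : sorted ltn [seq val i | i <- s].
  apply: (subseq_sorted ltn_trans (s2 := iota 0 n)).
    rewrite -val_enum_ord; apply: map_subseq.
    by rewrite /s [enum 'I_n]enumT /enum_mem; exact: filter_subseq.
  exact: iota_ltn_sorted.
have gi : increasing g.
  apply/forallP => i; apply/forallP => j; apply/implyP => ij.
  have := sorted_ltn_nth ltn_trans 0%N sord i j.
  rewrite !inE size_map sz !ltn_ord => /(_ isT isT ij).
  by rewrite !(nth_map (f i)) ?sz// -!gE.
have ginj : injective g.
  move=> i j gij; apply/val_inj/eqP.
  rewrite /= -(nth_uniq (f i) _ _ (enum_uniq (f @: 'I_d))) -/s ?sz//.
  by rewrite -!gE gij.
have fx i : exists k, g k == f i.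
  have fs : f i \in s by rewrite mem_enum imset_f.
  have lt : (index (f i) s < d)%N by rewrite (leq_trans _ (eq_leq sz)) ?index_mem.
  by exists (Ordinal lt); rewrite (gE (f i)) nth_index.
pose p0 i := xchoose (fx i).
have p0E i : g (p0 i) = f i by exact/eqP/(xchooseP (fx i)).
have p0i : injective p0 by move=> i j pij; apply: fi; rewrite -!p0E pij.
exists g, (odd_perm (perm p0i)); split => // T W.
have -> : rowsub f W = row_perm (perm p0i) (rowsub g W).
  by apply/matrixP => i j; rewrite !mxE permE p0E.
by rewrite row_permE det_mulmx det_perm.
Qed.

(** The Cauchy-Binet formula before the maps f are grouped by their images. *)
Lemma det_mulmx_rowsub (T : comNzRingType) (A : 'M[T]_(d, n)) (W : 'M[T]_(n, d)) :
  \det (A *m W) = \sum_(f : {ffun 'I_d -> 'I_n})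
    (\prod_i A i (f i)) * \det (rowsub f W).
Proof.
rewrite /determinant.
under eq_bigr => s _.
  have -> : \prod_i (A *m W) i (s i) = \sum_(f : {ffun 'I_d -> 'I_n})
       \prod_i (A i (f i) * W (f i) (s i)).
    by under eq_bigr do rewrite mxE; rewrite bigA_distr_bigA.
  rewrite mulr_sumr; over.
rewrite exchange_big /=; apply: eq_bigr => f _; rewrite mulr_sumr.
apply: eq_bigr => s _; rewrite big_split /= mulrCA; congr (_ * (_ * _)).
by apply: eq_bigr => i _; rewrite mxE.
Qed.

(** Cramer's rule: these are the minors obtained from the rows f by replacing
    one of them. *)
Lemma mul_adj_minor (T : comNzRingType) (W : 'M[T]_(n, d)) f k i :
  (W *m \adj (rowsub f W)) k i =
  \det (rowsub [ffun j => if j == i then k else f j] W).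
Proof.
rewrite (expand_det_row _ i) mxE; apply: eq_bigr => j _.
rewrite !mxE ffunE eqxx; congr (_ * _); rewrite /cofactor; congr (_ * \det _).
by apply/matrixP => a b; rewrite !mxE ffunE eq_sym (negPf (neq_lift _ _)).
Qed.

End Minors.

(** * Height and integer bases *)

Definition minor_gcd {n d} (W : 'M[int]_(n, d)) : nat :=
  \big[gcdn/0%N]_(I : {ffun 'I_d -> 'I_n} | increasing I) `|\det (rowsub I W)|%N.

Lemma minor_gcd_dvd {n d} (W : 'M[int]_(n, d)) (f : {ffun 'I_d -> 'I_n}) :
  (minor_gcd W %| \det (rowsub f W))%Z.
Proof.
have [->|[I [b [iI ->]]]] := minor_sort f; first exact: dvdz0.
apply: dvdz_mull; rewrite dvdzE /minor_gcd (bigD1 I)//=; exact: dvdn_gcdl.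
Qed.

(** The products u_j v_i and v_j u_i are equal; take their greatest common divisor
    over i. *)
Lemma primitive_proportional (R : realType) (T : finType) (P : pred T)
    (u v : T -> int) (c : R) :
  (forall i, P i -> (u i)%:~R = c * (v i)%:~R) ->
  \big[gcdn/0%N]_(i | P i) `|u i|%N = 1%N ->
  forall i, P i -> `|v i|%N = (`|u i| * \big[gcdn/0%N]_(i | P i) `|v i|)%N.
Proof.
move=> uv u1 j Pj.
have cross i : P i -> (`|u j| * `|v i| = `|v j| * `|u i|)%N.
  move=> Pi; rewrite -!abszM; congr absz; apply/eqP; rewrite -(eqr_int R).
  by rewrite !intrM !uv//; apply/eqP; ring.
have dist m (w : T -> int) : (m * \big[gcdn/0]_(i | P i) `|w i|)%N =
    \big[gcdn/0%N]_(i | P i) (m * `|w i|)%N.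
  by apply: (big_morph (muln m)); [exact: muln_gcdr|exact: muln0].
by rewrite dist (eq_bigr _ cross) -dist u1 muln1.
Qed.

Section Height.
Context {R : realType} {n : nat}.
Implicit Types B : {vspace 'cV[R]_n}.
Notation intr_mx := (map_mx (intr : int -> R)).

Lemma det_intr_rowsub d (W : 'M[int]_(n, d)) (f : 'I_d -> 'I_n) :
  \det (rowsub f (intr_mx W)) = (\det (rowsub f W))%:~R.
Proof.
have -> : rowsub f (intr_mx W) = intr_mx (rowsub f W).
  by apply/matrixP => i j; rewrite !mxE.
by rewrite det_map_mx.
Qed.

(** Any two bases of a subspace have proportional Pluecker coordinates, so every
    primitive representative is, up to sign, the family of the minors of W
    divided by their greatest common divisor. *)
Lemma height_minors B d (W : 'M[int]_(n, d)) : \dim B = d ->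
  basis_of B [seq col j (intr_mx W) | j <- enum 'I_d] -> (0 < minor_gcd W)%N ->
  height B * (minor_gcd W)%:R =
  Num.sqrt (\sum_(I : {ffun 'I_d -> 'I_n} | increasing I) (\det (rowsub I W))%:~R ^+ 2).
Proof.
move=> dB; subst d => bW; set g := minor_gcd W => g0.
have gN0 : (g%:R : R) != 0 by rewrite pnatr_eq0 -lt0n.
have gdvd I : increasing I -> (g %| `|\det (rowsub I W)|)%N.
  move=> iI; rewrite /g /minor_gcd (bigD1 I)//=; exact: dvdn_gcdl.
pose Xi0 := [ffun I : {ffun 'I_(\dim B) -> 'I_n} => (\det (rowsub I W) %/ g)%Z].
have Xi0E I : increasing I -> \det (rowsub I W) = Xi0 I * g.
  by move=> iI; rewrite ffunE divzK// dvdzE gdvd.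
have rep0 : plucker_representative Xi0.
  split.
    exists (intr_mx W), g%:R^-1; split; rewrite ?invr_eq0// => I iI.
    by rewrite det_intr_rowsub Xi0E// intrM mulrC mulfK.
  have h : (g * \big[gcdn/0%N]_(I | increasing I) `|Xi0 I|)%N = g.
    rewrite (big_morph (muln g) (muln_gcdr g) (muln0 g)).
    transitivity (minor_gcd W) => //.
    by apply: eq_bigr => I iI; rewrite Xi0E// abszM absz_nat mulnC.
  by apply/eqP; rewrite -(eqn_pmul2l g0) h muln1.
rewrite /height; set Xi := xget _ _.
have [[M [c [bM c0 XiE]]] Xi1] : plucker_representative Xi.
  by apply: (xgetPex 0); exists Xi0.
have [BW injW] := basis_colspan bW.
have [BM injM] := basis_colspan bM.
have MP : exists P, M = intr_mx W *m P.
  have /choice[x xE] j : exists x, col j M = intr_mx W *m x.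
    apply/colspanP; rewrite -BW; apply: (basis_mem bM).
    by apply: map_f; rewrite mem_enum.
  exists (\matrix_(i, j) x j i 0); apply/matrixP => i j.
  have /colP/(_ i) := xE j; rewrite !mxE => ->.
  by apply: eq_bigr => k _; rewrite !mxE.
have [P MPE] := MP.
have prop I : increasing I -> (Xi I)%:~R = c * \det P * (\det (rowsub I W))%:~R.
  move=> iI; rewrite XiE// -mulrA; congr (_ * _).
  have -> : rowsub I M = rowsub I (intr_mx W) *m P.
    by apply/matrixP => i j; rewrite MPE !mxE; apply: eq_bigr => k _; rewrite !mxE.
  by rewrite det_mulmx det_intr_rowsub mulrC.
have key I : increasing I -> `|\det (rowsub I W)|%N = (`|Xi I| * g)%N.
  by move=> iI; apply: (primitive_proportional prop Xi1).
rewrite -[X in _ * X]normr_nat -sqrtr_sqr -sqrtrM; last first.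
  by rewrite sumr_ge0// => I _; exact: sqr_ge0.
congr Num.sqrt; rewrite mulr_suml; apply: eq_bigr => I iI.
have absq (z : int) : (z%:~R : R) ^+ 2 = (`|z|%N%:R) ^+ 2.
  by rewrite natr_absz intr_norm real_normK ?num_real.
by rewrite !absq key// natrM exprMn.
Qed.

Lemma height_le B d (W : 'M[int]_(n, d)) : \dim B = d ->
  basis_of B [seq col j (intr_mx W) | j <- enum 'I_d] -> (0 < minor_gcd W)%N ->
  height B <=
  Num.sqrt (\sum_(I : {ffun 'I_d -> 'I_n} | increasing I) (\det (rowsub I W))%:~R ^+ 2).
Proof.
move=> dB bW g0; rewrite -(height_minors dB bW g0) ler_peMr ?ler1n//.
exact: sqrtr_ge0.
Qed.

Lemma minor_le_height B d (W : 'M[int]_(n, d)) f : \dim B = d ->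
  basis_of B [seq col j (intr_mx W) | j <- enum 'I_d] -> minor_gcd W = 1%N ->
  (`|\det (rowsub (f : {ffun 'I_d -> 'I_n}) W)|%N)%:R <= height B.
Proof.
move=> dB bW g1; have := height_minors dB bW; rewrite g1 mulr1 => -> //.
have [->|[I [b [iI ->]]]] := minor_sort f; first by rewrite absz0 sqrtr_ge0.
rewrite abszMsign.
rewrite natr_absz intr_norm -sqrtr_sqr ler_sqrt; last first.
  by rewrite sumr_ge0// => ? _; exact: sqr_ge0.
by rewrite (bigD1 I)//= lerDl sumr_ge0// => ? _; exact: sqr_ge0.
Qed.

End Height.

(** The minors of W generate the unit ideal, since det (U W) = 1 is an integral
    combination of them. *)
Lemma minor_gcd_leftinv {n d} (W : 'M[int]_(n, d)) (U : 'M[int]_(d, n)) :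
  U *m W = 1%:M -> minor_gcd W = 1%N.
Proof.
move=> UW; have : (minor_gcd W %| 1)%Z.
  rewrite -[1%Z](det1 int d) -UW det_mulmx_rowsub; apply: rpred_sum => f _.
  by apply: dvdz_mull; exact: minor_gcd_dvd.
by rewrite dvdzE dvdn1 => /eqP.
Qed.

Lemma common_denominator {R : realType} (T : finType) (x : T -> R) :
  (forall i, rational (x i)) ->
  exists2 k : int, k != 0 & exists z : T -> int, forall i, k%:~R * x i = (z i)%:~R.
Proof.
move=> xQ; have /choice[q qE] i : exists q : rat, x i = ratr q.
  by have [q _ <-] := xQ i; exists q.
exists (\prod_i denq (q i)).
  by apply/prodf_neq0 => i _; exact: denq_neq0.
exists (fun i => numq (q i) * \prod_(j | j != i) denq (q j)) => i.
rewrite qE (bigD1 i)//= !rmorphM/= /ratr mulrC mulrA divfK ?intr_eq0 ?denq_neq0//.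
Qed.

Section Rational.
Context {R : realType} {n : nat}.
Implicit Types B : {vspace 'cV[R]_n}.
Notation intr_mx := (map_mx (intr : int -> R)).

Lemma leftinv_inj d (W : 'M[int]_(n, d)) (U : 'M[int]_(d, n)) (x : 'cV[R]_d) :
  U *m W = 1%:M -> intr_mx W *m x = 0 -> x = 0.
Proof.
move=> UW /(congr1 (mulmx (intr_mx U))).
by rewrite mulmxA -map_mxM UW map_mx1 mul1mx mulmx0.
Qed.

(** The integer points of a rational subspace form a direct factor of the
    lattice of all integer points: by the Smith normal form, an integer basis
    spans the same subspace as the first d columns of a unimodular matrix. *)
Lemma rational_primitive_basis B d : rational_subspaces d B ->
  exists (W : 'M[int]_(n, d)) (U : 'M[int]_(d, n)),
    U *m W = 1%:M /\ B = colspan (intr_mx W).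
Proof.
move=> [dB [b [bB bQ]]].
have sb : size b = d by rewrite -dB (size_basis (X := in_tuple b) bB).
have dn : (d <= n)%N.
  by rewrite -dB (leq_trans (dimvS (subvf _)))// dimvf /dim/= muln1.
pose Mb : 'M[R]_(n, d) := \matrix_(i, j) b`_j i 0.
have [|k k0 [z zE]] := @common_denominator R _ (fun p : 'I_n * 'I_d => Mb p.1 p.2).
  by move=> [i j] /=; rewrite mxE; apply: bQ; rewrite mem_nth// sb.
pose M : 'M[int]_(n, d) := \matrix_(i, j) z (i, j).
have BM : (B <= colspan (intr_mx M))%VS.
  move/andP: bB => [/eqP <- _]; apply/span_subvP => X Xb.
  have jd : (index X b < d)%N by rewrite -[ltnRHS]sb index_mem.
  apply/colspanP; exists (\col_j ((j == Ordinal jd)%:R / k%:~R)).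
  rewrite mulmx_colE (bigD1 (Ordinal jd))//= big1 ?addr0.
    apply/colP => i; rewrite !mxE eqxx mul1r -zE/= mxE nth_index// mulKf//.
    by rewrite intr_eq0.
  by move=> j jX; rewrite mxE (negPf jX) mul0r scale0r.
have [L Lu [P Pu [e _ ME]]] := int_Smith_normal_form M.
pose W : 'M[int]_(n, d) := L *m pid_mx d.
pose D : 'M[int]_d := \matrix_(i, j) (e`_i *+ (i == j)).
have UW : (pid_mx d : 'M[int]_(d, n)) *m invmx L *m W = 1%:M.
  by rewrite /W mulmxA mulmxKV// mul_pid_mx minnn (minn_idPr dn) pid_mx_1.
have MW : M = W *m (D *m P).
  rewrite ME mulmxA; congr (_ *m P); rewrite /W -mulmxA; congr (_ *m _).
  apply/matrixP => i j; rewrite !mxE (bigD1 j)//= !mxE big1 ?addr0.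
    rewrite eqxx mulr1n; have [ij|ij] := eqVneq (i : nat) j.
      by rewrite ij ltn_ord mul1r.
    by rewrite mul0r mulr0n.
  by move=> l lj; rewrite !mxE (negPf lj) mulr0n mulr0.
exists W, (pid_mx d *m invmx L); split => //.
apply/eqP; rewrite eqEdim dB dim_colspan_le andbT.
by apply: subv_trans BM _; rewrite MW map_mxM; exact: colspan_sub.
Qed.

Lemma colspan_primitive d (W : 'M[int]_(n, d)) (U : 'M[int]_(d, n)) :
  U *m W = 1%:M -> \dim (colspan (intr_mx W)) = d /\
  basis_of (colspan (intr_mx W)) [seq col j (intr_mx W) | j <- enum 'I_d].
Proof.
move=> UW; have inj x := @leftinv_inj d W U x UW.
by split; [exact: dim_colspan|exact: colspan_basis].
Qed.

(** Choose f so that the minor of W on the rows f has the largest absolute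
    value; the bound on the entries of W adj(W_f) is then Cramer's rule. *)
Lemma reduced_basis B d : rational_subspaces d B ->
  exists (W : 'M[int]_(n, d)) (f : {ffun 'I_d -> 'I_n}),
  [/\ B = colspan (intr_mx W), \det (rowsub f W) != 0,
      `|\det (rowsub f W)|%N%:R <= height B &
      forall k i, (`|(W *m \adj (rowsub f W)) k i| <= `|\det (rowsub f W)|)%N].
Proof.
move=> /rational_primitive_basis[W [U [UW BW]]].
have [dB bB] := colspan_primitive UW.
have [f0 f0P] : exists f : {ffun 'I_d -> 'I_n}, \det (rowsub f W) != 0.
  apply/not_existsP => h; have := det1 int d; rewrite -UW det_mulmx_rowsub big1 //.
  by move=> f _; have /negP := h f; rewrite negbK => /eqP ->; rewrite mulr0.
pose f := [arg max_(f > f0) `|\det (rowsub f W)|%N]%N.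
have fmax (g : {ffun 'I_d -> 'I_n}) : (`|\det (rowsub g W)| <= `|\det (rowsub f W)|)%N.
  rewrite /f; case: arg_maxnP => // h _ hm. exact: hm.
exists W, f; split => //.
- by rewrite -absz_gt0 (leq_trans _ (fmax f0))// absz_gt0.
- by rewrite BW; apply: minor_le_height => //; exact: (minor_gcd_leftinv UW).
- by move=> k i; rewrite mul_adj_minor; exact: fmax.
Qed.

End Rational.

(** * Short integer vectors *)

Lemma absz_unit_det d (L : 'M[int]_d) : L \in unitmx -> `|\det L|%N = 1%N.
Proof. by rewrite unitmxE => /orP[]/eqP->. Qed.

(** Dirichlet's pigeonhole principle: the image of G has index |det G| in the
    integer lattice, hence two of the points of the box with (m + 1)^d elements
    are congruent modulo this image. By the Smith normal form the congruence
    means that certain coordinates are congruent modulo the diagonal entries. *)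
Lemma pigeonhole_lattice d (G : 'M[int]_d) m : \det G != 0 ->
  (`|\det G| < m.+1 ^ d)%N ->
  exists z : 'cV[int]_d, z != 0 /\ forall i, (`|(G *m z) i 0%R| <= m)%N.
Proof.
move=> G0 Gm; have [L Lu [P Pu [e _ GE]]] := int_Smith_normal_form G.
pose c (i : 'I_d) := `|nth 0%R e i|%N.
have cG : (\prod_i c i)%N = `|\det G|%N.
  have DE : \matrix_(i, j) (nth 0 e i *+ (i == j :> nat)) =
            diag_mx (\row_(i < d) nth 0 e i).
    by apply/matrixP => i j; rewrite !mxE.
  rewrite GE DE !det_mulmx !abszM (absz_unit_det Lu) (absz_unit_det Pu).
  rewrite mul1n muln1 det_diag.
  rewrite (big_morph absz abszM (erefl _)); apply: eq_bigr => i _.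
  by rewrite mxE.
have c0 i : (0 < c i)%N.
  have : (0 < \prod_i c i)%N by rewrite cG absz_gt0.
  by rewrite (bigD1 i)//= muln_gt0 => /andP[].
pose N := (\max_i c i)%N.
pose vec (x : {ffun 'I_d -> 'I_m.+1}) : 'cV[int]_d := \col_i (x i : int).
pose res x i := `|((invmx L *m vec x) i 0%R %% c i)%Z|%N.
have resc x i : (res x i < c i)%N.
  have ci0 : (c i : int) != 0 by rewrite -absz_eq0 absz_nat -lt0n.
  rewrite -ltz_nat /res gez0_abs ?modz_ge0//.
  by rewrite ltz_pmod// ltz_nat.
have resN x i : (res x i < N.+1)%N.
  by rewrite ltnS (leq_trans (ltnW (resc x i)))// leq_bigmax.
pose phi (x : {ffun 'I_d -> 'I_m.+1}) : {ffun 'I_d -> 'I_N.+1} :=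
  [ffun i => Ordinal (resN x i)].
have /injectivePn[x [y xy pxy]] : ~~ injectiveb phi.
  apply: contraL Gm => /injectiveP phii; rewrite -leqNgt -cG.
  have -> : (m.+1 ^ d)%N = #|{ffun 'I_d -> 'I_m.+1}| by rewrite card_ffun !card_ord.
  pose F (i : 'I_d) := [pred k : 'I_N.+1 | (k < c i)%N].
  rewrite -(card_codom phii) (leq_trans (n := #|family F|))//.
    apply: subset_leq_card; apply/fintype.subsetP => _ /codomP[x ->].
    by apply/familyP => i; rewrite ffunE inE /=.
  rewrite card_family foldrE big_map big_enum /= leq_prod// => i _.
  rewrite -[leqRHS]card_ord -[leqRHS]/#|'I_(c i)|.
  apply: leq_trans (leq_image_card (fun j : 'I_(c i) => inord j) xpredT).
  apply: subset_leq_card; apply/fintype.subsetP => k kc.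
  apply/fintype.imageP; exists (Ordinal (kc : (k < c i)%N)) => //.
  by apply/val_inj; rewrite /= inordK.
have wE i : exists w : int, (invmx L *m (vec x - vec y)) i 0 = nth 0 e i * w.
  have : ((invmx L *m vec x) i 0%R = (invmx L *m vec y) i 0%R %[mod c i])%Z.
    have /(congr1 val) /= : phi x i = phi y i by rewrite pxy.
    have ci0 : (c i : int) != 0 by rewrite -absz_eq0 absz_nat -lt0n.
    have rE u : (res u i : int) = ((invmx L *m vec u) i 0%R %% c i)%Z.
      by rewrite /res gez0_abs// modz_ge0.
    by rewrite !ffunE /= => rxy; rewrite -!rE rxy.
  move=> /eqP; rewrite eqz_mod_dvd dvdzE absz_nat -dvdzE => /dvdzP[w wE].
  exists w; rewrite mulrC -wE mulmxBr [LHS]mxE; congr (_ + _); by rewrite mxE.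
have [w wi] := choice wE.
exists (invmx P *m \col_i w i).
have GzE : G *m (invmx P *m \col_i w i) = vec x - vec y.
  rewrite GE -mulmxA mulKVmx// -mulmxA.
  rewrite (_ : _ *m (\col_i w i) = invmx L *m (vec x - vec y)) ?mulKVmx//.
  apply/colP => i; rewrite wi mxE (bigD1 i)//= big1 ?addr0 => [|j ji].
    by rewrite !mxE eqxx mulr1n.
  by rewrite !mxE -[(i == j :> nat)]/(i == j) eq_sym (negPf ji) mulr0n mul0r.
split.
  apply: contraNneq xy => z0; apply/eqP/ffunP => i; apply/val_inj.
  have := GzE; rewrite z0 mulmx0 => /esym/eqP; rewrite subr_eq0 => /eqP/colP/(_ i).
  by rewrite !mxE => -[].
move=> i; rewrite GzE !mxE.
have := ltn_ord (x i); have := ltn_ord (y i).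
move: (nat_of_ord (x i)) (nat_of_ord (y i)) => a b; lia.
Qed.

Section ShortVector.
Context {R : realType} {n : nat}.
Implicit Types B : {vspace 'cV[R]_n}.
Notation intr_mx := (map_mx (intr : int -> R)).

Lemma absz_sum_le (I : finType) (F : I -> int) (c : nat) :
  (forall i, (`|F i| <= c)%N) -> (`|(\sum_i F i)%R| <= #|I| * c)%N.
Proof.
move=> Fc; have : (`|(\sum_i F i)%R| <= \sum_i `|F i|)%N.
  elim/big_ind2 : _ => [//|a b a' b' h h'|//].
  by apply: leq_trans (leq_add h h'); lia.
by move/leq_trans; apply; rewrite -sum_nat_const leq_sum.
Qed.

(** A form of Minkowski's first theorem: with f as in the reduced basis, the
    integer points of B project to the coordinates f onto a lattice of index at
    most the height, and the inverse of this projection has entries bounded by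
    1. *)
Lemma short_vector B d : (0 < d)%N -> rational_subspaces d B ->
  exists (y : 'cV[int]_n) (m : nat),
  [/\ y != 0, intr_mx y \in B, m%:R ^+ d <= height B &
      forall i, (`|y i 0%R| <= d * m)%N].
Proof.
move=> d0 /reduced_basis[W [f [BW G0 GH TG]]].
set G := rowsub f W in G0 GH TG; set N := `|\det G|%N in GH TG.
have N0 : (0 < N)%N by rewrite absz_gt0.
have exm : exists m, (N < m.+1 ^ d)%N.
  exists N; rewrite (@leq_trans (N.+1 ^ 1)%N)// leq_exp2l//; lia.
case: (ex_minnP exm) => m Nm mmin.
have mN : (m ^ d <= N)%N.
  case: m Nm mmin => [|m] Nm mmin; first by rewrite exp0n.
  by rewrite leqNgt; apply/negP => /mmin; rewrite ltnn.
have [z [z0 zm]] := pigeonhole_lattice G0 Nm.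
have GzE : rowsub f (W *m z) = G *m z.
  by apply/matrixP => i j; rewrite !mxE; apply: eq_bigr => k _; rewrite !mxE.
exists (W *m z), m; split.
- apply: contraNneq z0 => Wz; have : \adj G *m (G *m z) = 0.
    rewrite -GzE Wz; apply/matrixP => i j; rewrite [LHS]mxE [RHS]mxE.
    by rewrite big1// => k _; rewrite !mxE mulr0.
  rewrite mulmxA mul_adj_mx mul_scalar_mx => /eqP.
  by rewrite scalemx_eq0 (negPf G0).
- by rewrite BW map_mxM; apply/colspanP; eexists.
- by rewrite -natrX (le_trans _ GH)// ler_nat.
move=> k; rewrite -(leq_pmul2l N0) -abszM.
have -> : \det G * (W *m z) k 0 = (W *m \adj G *m (G *m z)) k 0.
  by rewrite -mulmxA (mulmxA (\adj G)) mul_adj_mx mul_scalar_mx -scalemxAr [RHS]mxE.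
rewrite mxE mulnCA -[X in (_ <= X * _)%N]card_ord; apply: absz_sum_le => i.
by rewrite abszM leq_mul.
Qed.

(** Northcott's finiteness property: a rational subspace is spanned by the
    columns of the matrix W adj(W_f) of its reduced basis, whose entries are
    integers bounded by the height. *)
Lemma finite_height_le d (K : R) :
  finite_set [set B : {vspace 'cV[R]_n} | rational_subspaces d B /\ height B <= K].
Proof.
pose k := Num.truncn K.
pose T (x : 'M['I_(k + k).+1]_(n, d)) : 'M[int]_(n, d) :=
  \matrix_(i, j) ((x i j : int) - k%:Z).
apply: (@sub_finite_set _ _ ((fun x => colspan (intr_mx (T x))) @` setT)); last first.
  by apply: finite_image; exact: finite_finset.
move=> B [/reduced_basis[W [f [BW G0 GH TG]]] BK].
set G := rowsub f W in G0 GH TG.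
have Nk : (`|\det G| <= k)%N.
  have GK := le_trans GH BK.
  by rewrite truncn_ge_nat// (le_trans _ GK).
pose A := W *m \adj G.
exists (\matrix_(i, j) inord `|(A i j + k%:Z)%R|%N) => //.
have -> : T (\matrix_(i, j) inord `|(A i j + k%:Z)%R|%N) = A.
  apply/matrixP => i j; have := leq_trans (TG i j) Nk.
  rewrite -/A /T [LHS]mxE mxE; move: (A i j) => a al.
  by rewrite inordK; move: al; lia.
rewrite BW /A map_mxM; apply/eqP; rewrite eqEsubv colspan_sub/=.
apply/subvP => X /colspanP[x ->]; apply/colspanP.
exists ((\det G)%:~R^-1 *: (intr_mx G *m x)).
rewrite -scalemxAr -mulmxA (mulmxA (intr_mx (\adj G))) -map_mxM mul_adj_mx.
rewrite map_scalar_mx mul_scalar_mx -scalemxAr scalerA mulVf ?scale1r//.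
by rewrite intr_eq0.
Qed.

End ShortVector.

(** * Lower bound *)

Lemma det_norm_le {R : realType} d (A : 'M[R]_d) (c : R) :
  (forall i j, `|A i j| <= c) -> `|\det A| <= d`!%:R * c ^+ d.
Proof.
move=> Ac; apply: le_trans (ler_norm_sum _ _ _) _.
rewrite -card_Sn mulr_natl -sumr_const; apply: ler_sum => s _.
rewrite normrM normrX normrN1 expr1n mul1r normr_prod.
rewrite -[X in c ^+ X]card_ord -prodr_const.
by apply: ler_prod => i _; rewrite normr_ge0 Ac.
Qed.

Section LowerBound.
Context {R : realType} {n : nat}.
Implicit Types A B : {vspace 'cV[R]_n}.
Notation intr_mx := (map_mx (intr : int -> R)).

Lemma height_gt0 B d : rational_subspaces d B -> 0 < height B.
Proof.
move=> /reduced_basis[W [f [_ G0 GH _]]].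
by apply: lt_le_trans GH; rewrite ltr0n absz_gt0.
Qed.

Lemma echelon_basis A d : \dim A = d ->
  exists (G : 'M[R]_(n, d)) (f : {ffun 'I_d -> 'I_n}),
    A = colspan G /\ rowsub f G = 1%:M.
Proof.
move=> dA; pose M : 'M[R]_(n, d) := \matrix_(i, j) (vbasis A)`_j i 0.
have bM : basis_of A [seq col j M | j <- enum 'I_d].
  suff -> : [seq col j M | j <- enum 'I_d] = vbasis A by exact: vbasisP.
  apply: (@eq_from_nth _ 0); first by rewrite size_map size_enum_ord size_tuple.
  move=> i; rewrite size_map size_enum_ord => id.
  rewrite (nth_map (Ordinal id)) ?size_enum_ord//.
  by apply/colP => k; rewrite !mxE nth_enum_ord.
have [AM injM] := basis_colspan bM.
have fullM : row_full M.
  have coker0 : cokermx M = 0.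
    apply/matrixP => i j; have : col j (cokermx M) = 0.
      by apply: injM; rewrite colE mulmxA mulmx_coker mul0mx.
    by move=> /colP/(_ i); rewrite !mxE.
  have := mxrank_coker M; rewrite coker0 mxrank0 => /esym/eqP; rewrite subn_eq0 => le.
  by rewrite /row_full eqn_leq rank_leq_col.
have Mu := fullrowsub_unit fullM; set f := fullrankfun _ in Mu.
exists (M *m invmx (rowsub f M)), f; split; last first.
  by rewrite -mul_rowsub_mx mulmxV.
apply/eqP; rewrite AM eqEsubv colspan_sub andbT.
by rewrite -{1}(mulmxKV Mu M) colspan_sub.
Qed.

Section Approximations.
Context (d : nat) (A : {vspace 'cV[R]_n}).
Context (G : 'M[R]_(n, d)) (f : {ffun 'I_d -> 'I_n}).
Context (AG : A = colspan G) (fG : rowsub f G = 1%:M).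

Let P (q : nat) : 'M[int]_(n, d) := \matrix_(i, j) Num.floor (q%:R * G i j).
Let B q : {vspace 'cV[R]_n} := colspan (intr_mx (P q)).

(** Rounding leaves the integer block f untouched. *)
Lemma approx_rows q : rowsub f (P q) = q%:Z%:M.
Proof.
apply/matrixP => i j; rewrite !mxE.
have := congr1 (fun M : 'M[R]_d => M i j) fG; rewrite !mxE => ->.
have [_|_] := eqVneq i j; last by rewrite mulr0 mulr0n floor0.
by rewrite mulr1 mulr1n -[q%:R]/(q%:Z%:~R) intrKfloor.
Qed.

Lemma approx_det q : \det (rowsub f (P q)) = q%:Z ^+ d.
Proof. by rewrite approx_rows det_scalar. Qed.

Lemma approx_coord q (x : 'cV[R]_d) j : (intr_mx (P q) *m x) (f j) 0 = q%:R * x j 0.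
Proof.
have -> : (intr_mx (P q) *m x) (f j) 0 = (intr_mx (rowsub f (P q)) *m x) j 0.
  by rewrite !mxE; apply: eq_bigr => k _; rewrite !mxE.
by rewrite approx_rows map_scalar_mx mul_scalar_mx mxE.
Qed.

Lemma base_coord (x : 'cV[R]_d) j : (G *m x) (f j) 0 = x j 0.
Proof.
have -> : (G *m x) (f j) 0 = (rowsub f G *m x) j 0.
  by rewrite !mxE; apply: eq_bigr => k _; rewrite !mxE.
by rewrite fG mul1mx.
Qed.

Lemma approx_inj q (x : 'cV[R]_d) : (0 < q)%N -> intr_mx (P q) *m x = 0 -> x = 0.
Proof.
move=> q0 Px; apply/colP => j; have := approx_coord q x j; rewrite Px !mxE.
by move=> /esym/eqP; rewrite mulf_eq0 pnatr_eq0 (gtn_eqF q0) => /eqP.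
Qed.

Lemma approx_basis q : (0 < q)%N ->
  basis_of (B q) [seq col j (intr_mx (P q)) | j <- enum 'I_d].
Proof. by move=> q0; apply: colspan_basis => x; exact: approx_inj. Qed.

Lemma approx_dim q : (0 < q)%N -> \dim (B q) = d.
Proof. by move=> q0; apply: dim_colspan => x; exact: approx_inj. Qed.

Lemma approx_rational q : (0 < q)%N -> rational_subspaces d (B q).
Proof.
move=> q0; split; first exact: approx_dim.
exists [seq col j (intr_mx (P q)) | j <- enum 'I_d]; split; first exact: approx_basis.
move=> X /mapP[j _ ->] i; rewrite !mxE; exists (P q i j)%:~R => //.
by rewrite ratr_int mxE.
Qed.

Lemma approx_entry q i j : (0 < q)%N -> `|G i j - (P q i j)%:~R / q%:R| <= q%:R^-1.
Proof.
move=> q0; rewrite mxE; set t := q%:R * G i j.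
have q0' : (q%:R : R) != 0 by rewrite pnatr_eq0 -lt0n.
have -> : G i j - (Num.floor t)%:~R / q%:R = (t - (Num.floor t)%:~R) / q%:R.
  by rewrite mulrBl [t * _]mulrC mulKf.
have /andP[f1 f2] := floor_itv t; rewrite rmorphD/= in f2.
rewrite normrM normfV normr_nat ler_piMl ?invr_ge0//.
by rewrite ger0_norm ?subr_ge0//; move: f2; lra.
Qed.

Lemma approx_dist q (x : 'cV[R]_d) i : (0 < q)%N ->
  `|(G *m x) i 0 - q%:R^-1 * (intr_mx (P q) *m x) i 0| <= (\sum_j `|x j 0|) / q%:R.
Proof.
move=> q0; rewrite !mxE mulr_sumr -sumrB mulr_suml.
apply: le_trans (ler_norm_sum _ _ _) _; apply: ler_sum => j _.
have -> : G i j * x j 0 - q%:R^-1 * (intr_mx (P q) i j * x j 0) =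
   (G i j - (P q i j)%:~R / q%:R) * x j 0 by rewrite [intr_mx _ _ _]mxE; ring.
by rewrite normrM mulrC ler_wpM2l// approx_entry.
Qed.

(** The vectors G x of A and P_q x / q of B_q are within O(|x| / q) of each
    other, and |x| <= |G x| since x consists of the coordinates f of G x. *)
Lemma approx_psi q : (0 < d)%N -> \dim A = d -> (0 < q)%N ->
  psi d A (B q) <= (n * d)%:R / q%:R.
Proof.
move=> d0 dA q0; apply: psi_le_dist => //; first exact: approx_dim.
rewrite AG => X /colspanP[x ->]; set X' := G *m x.
exists (q%:R^-1 *: (intr_mx (P q) *m x)); first by apply/memvZ/colspanP; exists x.
have xX j : `|x j 0| <= enorm X'.
  rewrite -(base_coord x j) -/X' enormE -sqrtr_sqr ler_sqrt ?dot_ge0//.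
  rewrite /dot (bigD1 (f j))//= expr2 lerDl sumr_ge0// => k _.
  by rewrite -expr2 sqr_ge0.
have sX : \sum_j `|x j 0| <= d%:R * enorm X'.
  rewrite -[X in X%:R]card_ord mulr_natl -sumr_const; exact: ler_sum.
have eX : 0 <= enorm X' by rewrite enormE sqrtr_ge0.
have subZE (a : R) (U V : 'cV[R]_n) i : (U - a *: V) i 0 = U i 0 - a * V i 0.
  by rewrite !mxE.
have nn : 0 <= d%:R / q%:R * enorm X' by rewrite mulr_ge0// divr_ge0.
apply: (@le_trans _ _ (\sum_(i < n) (d%:R / q%:R * enorm X') ^+ 2)).
  apply: ler_sum => i _; rewrite -expr2 -real_normK ?num_real// ler_sqr ?nnegrE//.
  rewrite subZE (le_trans (approx_dist _ _ q0))//.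
  by rewrite mulrAC ler_wpM2r// invr_ge0.
rewrite sumr_const card_ord -[leLHS]mulr_natl exprMn enormE sqr_sqrtr ?dot_ge0//.
rewrite mulrA ler_wpM2r ?dot_ge0// natrM -[n%:R * d%:R / q%:R]mulrA [leRHS]exprMn.
by rewrite ler_wpM2r ?sqr_ge0// -natrX ler_nat; case: (n) => // m; rewrite leq_pmulr.
Qed.

(** The minors of P q are bounded by d! times the d-th power of a bound O(q) on
    its entries. *)
Lemma approx_height : exists2 C : R, 0 < C &
  forall q, (0 < q)%N -> height (B q) <= C * q%:R ^+ d.
Proof.
pose K := 1 + \sum_i \sum_j `|G i j|.
have GK i j : `|G i j| <= K - 1.
  rewrite /K addrAC subrr add0r (bigD1 i)//= (bigD1 j)//= -addrA lerDl.
  by rewrite addr_ge0 ?sumr_ge0// => k _; rewrite sumr_ge0.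
have K1 : 1 <= K by rewrite lerDl sumr_ge0// => i _; rewrite sumr_ge0.
have K0 : 0 <= K by rewrite (le_trans _ K1).
pose c := d`!%:R * K ^+ d; pose s := #|{ffun 'I_d -> 'I_n}|.
have c0 : 0 <= c by rewrite mulr_ge0// exprn_ge0// (le_trans _ K1).
exists (1 + Num.sqrt s%:R * c); first by rewrite ltr_pwDl// mulr_ge0 ?sqrtr_ge0.
move=> q q0; have g0 : (0 < minor_gcd (P q))%N.
  rewrite lt0n; apply/eqP => g0; have := minor_gcd_dvd (P q) f.
  by rewrite g0 dvd0z approx_det expf_eq0 => /andP[_]; rewrite -absz_eq0 (gtn_eqF q0).
apply: le_trans (height_le (approx_dim q0) (approx_basis q0) g0) _.
have Pq i j : `|(P q i j)%:~R| <= K * q%:R :> R.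
  have q0' : 0 < q%:R :> R by rewrite ltr0n.
  rewrite -ler_pdivrMr// -[X in _ / X]normr_nat -normf_div.
  have := approx_entry i j q0; have := GK i j; have q1 : q%:R^-1 <= 1 :> R.
    by rewrite invf_le1// ler1n.
  move=> h1 h2; have := ler_normB (G i j) (G i j - (P q i j)%:~R / q%:R).
  by rewrite subKr; lra.
apply: (@le_trans _ _ (Num.sqrt (s%:R * (c * q%:R ^+ d) ^+ 2))).
  rewrite ler_wsqrtr// mulr_natl -sumr_const big_mkcond; apply: ler_sum => I _.
  case: ifP => _; last exact: sqr_ge0.
  rewrite -det_intr_rowsub -real_normK ?num_real//.
  rewrite ler_sqr ?nnegrE ?mulr_ge0 ?exprn_ge0//.
  rewrite /c -mulrA -exprMn; apply: det_norm_le => i j; rewrite !mxE.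
  by have := Pq (I i) j; rewrite mxE.
rewrite sqrtrM// sqrtr_sqr ger0_norm ?mulr_ge0 ?exprn_ge0//.
by rewrite mulrA ler_wpM2r ?exprn_ge0// lerDr.
Qed.

(** Two such subspaces B q that coincide have the same element with given
    coordinates f, which is then at distance O(1/q) from the corresponding
    element of A. *)
Lemma approx_distinct (C : {vspace 'cV[R]_n}) : \dim A = d -> \dim C = d -> A <> C ->
  exists Q, forall q, (Q <= q)%N -> B q <> C.
Proof.
move=> dA dC AneC; apply: contrapT => /forallNP h; apply: AneC.
have {}h Q : exists2 q, (Q < q)%N & B q = C.
  have /existsNP[q /not_implyP[Qq /contrapT BC]] := h Q.+1; by exists q.
apply/eqP; rewrite eqEdim dA dC leqnn andbT; apply/subvP; rewrite AG.
move=> _ /colspanP[x ->]; have [p p0 Bp] := h 0%N.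
have pN0 : (p%:R : R) != 0 by rewrite pnatr_eq0 -lt0n.
suff -> : G *m x = p%:R^-1 *: (intr_mx (P p) *m x).
  by rewrite -Bp; apply/memvZ/colspanP; exists x.
have same q : (0 < q)%N -> B q = C ->
    q%:R^-1 *: (intr_mx (P q) *m x) = p%:R^-1 *: (intr_mx (P p) *m x).
  move=> q0 Bq; have qN0 : (q%:R : R) != 0 by rewrite pnatr_eq0 -lt0n.
  have : q%:R^-1 *: (intr_mx (P q) *m x) \in B p.
    by rewrite Bp -Bq; apply/memvZ/colspanP; exists x.
  move=> /colspanP[w wE]; rewrite wE scalemxAr; congr (_ *m _).
  apply/colP => j; have := congr1 (fun Y : 'cV[R]_n => Y (f j) 0) wE.
  by rewrite [LHS]mxE !approx_coord mulKf// => xw; rewrite mxE xw mulKf.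
apply/colP => i; apply/eqP; rewrite -subr_eq0 -normr_le0 leNgt; apply/negP.
set e := `|_| => e0; set c := \sum_j `|x j 0|.
have c0 : 0 <= c by rewrite sumr_ge0.
have [q qlt Bq] := h (Num.truncn (c / e)).
have q0 : (0 < q)%N by rewrite (leq_ltn_trans _ qlt).
have := approx_dist x i q0; have := same q q0 Bq => /colP/(_ i).
rewrite [LHS]mxE => ->; rewrite -/c -[X in X <= _]/e leNgt => /negP; apply.
rewrite ltr_pdivrMr ?ltr0n// mulrC -ltr_pdivrMr//.
by rewrite (lt_le_trans (truncnS_gt _))// ler_nat.
Qed.

End Approximations.

(** Rounding the echelon basis of A to multiples of 1/q gives a rational subspace
    of height O(q^d) all of whose principal angles with A are O(1/q). *)
Lemma mu_ge_inv A d : (0 < d)%N -> irrational_subspaces d d d A ->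
  (((d%:R : R)^-1)%:E <= mu A d d)%E.
Proof.
move=> d0 [dA irr]; have [G [f [AG fG]]] := echelon_basis dA.
have [C C0 HC] := approx_height fG.
have nC B : rational_subspaces d B -> A <> B.
  by move=> rB AB; have := irr _ rB; rewrite -AB capvv dA ltnn.
have key (b : R) : 0 < b -> b < d%:R^-1 -> (b%:E <= mu A d d)%E.
  move=> b0 bd; apply: ereal_sup_ubound; exists b => //; split => //.
  pose D : R := 1 + (n * d)%:R; have D0 : 0 < D by rewrite ltr_pwDl.
  have d0' : 0 < d%:R :> R by rewrite ltr0n.
  have bd1 : 0 < 1 - d%:R * b by rewrite subr_gt0 mulrC -ltr_pdivlMr// div1r.
  (* q >= Q0 makes D C^b <= q^(1 - d b), that is D / q <= (C q^d)^(-b). *)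
  pose Q0 := (Num.truncn ((D * C `^ b) `^ (1 - d%:R * b)^-1)).+1.
  set S := (X in infinite_set X).
  pose Bq q : {vspace 'cV[R]_n} :=
    colspan (intr_mx (\matrix_(i, j) Num.floor (q%:R * G i j))).
  have SB q : (Q0 <= q)%N -> S (Bq q).
    move=> Qq; have q0 : (0 < q)%N by rewrite (leq_trans _ Qq).
    have rB := approx_rational fG q0; split => //.
    apply: le_trans (approx_psi AG fG d0 dA q0) _.
    have q0' : 0 < q%:R :> R by rewrite ltr0n.
    apply: (@le_trans _ _ (D / q%:R)); first by rewrite ler_wpM2r ?invr_ge0// lerDr.
    rewrite powRN; have HB := height_gt0 rB.
    rewrite -[leLHS]invf_div lef_pV2 ?posrE ?powR_gt0 ?divr_gt0//.
    apply: (@le_trans _ _ ((C * q%:R ^+ d) `^ b)).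
      apply: ge0_ler_powR; rewrite ?nnegrE ?(ltW b0) ?(ltW HB)//; last exact: HC.
      by rewrite mulr_ge0 ?(ltW C0) ?exprn_ge0.
    rewrite powRM ?(ltW C0) ?exprn_ge0// -powR_mulrn// -powRrM ler_pdivlMr//.
    have qE : (q%:R : R) = q%:R `^ (1 - d%:R * b) * q%:R `^ (d%:R * b).
      by rewrite -powRD ?subrK ?powRr1// (gt_eqF q0') implybT.
    rewrite [leRHS]qE mulrAC ler_wpM2r ?powR_ge0// mulrC.
    have E0 : 0 <= D * C `^ b by rewrite mulr_ge0 ?powR_ge0// ltW.
    rewrite [leLHS](_ : _ = (D * C `^ b) `^ (1 - d%:R * b)^-1 `^ (1 - d%:R * b)).
      2: by rewrite -powRrM mulVf ?powRr1// gt_eqF.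
    apply: ge0_ler_powR; rewrite ?nnegrE ?powR_ge0 ?(ltW bd1)//.
    by rewrite (le_trans (ltW (truncnS_gt _)))// ler_nat.
  move=> /finite_seqP[s sE].
  have BsC B : B \in s -> exists Q, forall q, (Q <= q)%N -> Bq q <> B.
    move=> Bs; have [rB _] : S B by rewrite sE.
    by apply: (approx_distinct AG fG dA) => //; [case: rB|exact: nC].
  have [Q hQ] : exists Q, forall B, B \in s -> forall q, (Q <= q)%N -> Bq q <> B.
    elim: s {sE} BsC => [|B s IH] h; first by exists 0%N.
    have [Q1 h1] := h B (mem_head _ _).
    have [|Q2 h2] := IH; first by move=> B' B's; apply: h; rewrite inE B's orbT.
    exists (maxn Q1 Q2) => B'; rewrite inE => B's q.
    rewrite geq_max => /andP[le1 le2]; case/orP: B's => [/eqP->|B's].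
      exact: h1.
    exact: h2 B's _ le2.
  have := SB (maxn Q0 Q) (leq_maxl _ _); rewrite sE => /= Bs.
  exact: (hQ _ Bs _ (leq_maxr _ _)).
have d0' : 0 < (d%:R : R)^-1 by rewrite invr_gt0 ltr0n.
apply/lee_subgt0Pr => e e0.
have [b0 bd] : 0 < Num.max (d%:R^-1 / 2) (d%:R^-1 - e) /\
               Num.max (d%:R^-1 / 2) (d%:R^-1 - e) < d%:R^-1.
  by split; [rewrite lt_max divr_gt0|rewrite gt_max; apply/andP; split; lra].
apply: le_trans (key _ b0 bd).
by rewrite -EFinB lee_fin le_max lexx orbT.
Qed.

End LowerBound.

(** * A totally real algebraic integer of degree n *)

(** The constant 2 makes the polynomial Eisenstein at 2, and the roots 4 i of the
    product are so far apart that adding 2 leaves all of them real. *)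
Definition trpoly (n : nat) : {poly int} :=
  \prod_(i < n) ('X - (4 * i)%:Z%:P) + 2%:P.

Section TotallyReal.
Context {R : realType}.
Notation intr_poly := (map_poly (intr : int -> R)).

Lemma prod_mod4 n : exists g : {poly int},
  \prod_(i < n) ('X - (4 * i)%:Z%:P) = 'X^n + 4%:P * g.
Proof.
elim: n => [|n [g IH]]; first by exists 0; rewrite big_ord0 mulr0 addr0.
exists (g * ('X - (4 * n)%:Z%:P) - n%:Z%:P * 'X^n).
rewrite big_ord_recr/= IH PoszM polyCM exprS; ring.
Qed.

Lemma size_prod4 n : size (\prod_(i < n) ('X - (4 * i)%:Z%:P)) = n.+1.
Proof. by rewrite size_prod_XsubC /index_enum -enumT size_enum_ord. Qed.

Lemma trpoly_size n : (0 < n)%N -> size (trpoly n) = n.+1.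
Proof.
move=> n0; rewrite /trpoly size_polyDl size_prod4//.
by rewrite (leq_ltn_trans (size_polyC_leq1 _)).
Qed.

Lemma trpoly_monic n : (0 < n)%N -> trpoly n \is monic.
Proof.
move=> n0; rewrite monicE /trpoly lead_coefDl ?size_prod4.
  by rewrite -monicE monic_prod_XsubC.
by rewrite (leq_ltn_trans (size_polyC_leq1 _)).
Qed.

Lemma trpoly_irreducible n : (0 < n)%N -> irreducible_poly (trpoly n).
Proof.
move=> n0; have sz := trpoly_size n0; apply: (@eisenstein_crit 2) => //.
- by rewrite sz; case: n n0 {sz}.
- by rewrite (monicP (trpoly_monic n0)).
- have -> : (trpoly n)`_0 = 2.
    rewrite -horner_coef0 /trpoly hornerD hornerC horner_prod.
    by case: n n0 {sz} => // n _; rewrite big_ord_recl hornerXsubC muln0 subr0 mul0r.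
  by [].
move=> i; rewrite sz /= => lin; have [g gE] := prod_mod4 n.
rewrite /trpoly gE !coefD coefXn (ltn_eqF lin) add0r coefCM coefC.
apply: rpredD; first by apply: dvdz_mulr.
by case: ifP.
Qed.

Lemma trpoly_horner n (x : R) :
  (intr_poly (trpoly n)).[x] = \prod_(i < n) (x - (4 * i)%:R) + 2.
Proof.
rewrite rmorphD rmorph_prod/= hornerD map_polyC hornerC horner_prod; congr (_ + _).
by apply: eq_bigr => i _; rewrite rmorphB/= map_polyX map_polyC !hornerE.
Qed.

(** At the point 4 k - 2 all the factors x - 4 i have absolute value at least 2,
    and n - k of them are negative; so their product has absolute value at least
    2^n > 2. *)
Lemma trpoly_sign n k : (2 <= n)%N -> (k <= n)%N ->
  0 < (-1) ^+ (n - k) * (intr_poly (trpoly n)).[4 * k%:R - 2].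
Proof.
move=> n2 kn; rewrite trpoly_horner.
set P := \prod_(i < n) _.
have big : 2 ^+ n <= (-1) ^+ (n - k) * P.
  rewrite {}/P; elim: n kn {n2} => [|n IH].
    by rewrite leqn0 => /eqP ->; rewrite big_ord0 !expr0 mulr1.
  rewrite leq_eqVlt => /orP[/eqP kn|].
    rewrite kn subnn mul1r -[X in _ ^+ X]card_ord -prodr_const ler_prod// => i _.
    rewrite ler0n/= natrM; have : i%:R <= n%:R :> R by rewrite ler_nat -ltnS.
    by rewrite mulrS; lra.
  rewrite ltnS => kn; rewrite subSn// exprS big_ord_recr/= exprSr.
  have := IH kn; set p := \prod_(_ | _) _ => h.
  rewrite [leRHS](_ : _ = ((-1) ^+ (n - k) * p) * (4 * n%:R + 2 - 4 * k%:R)); last first.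
    by rewrite natrM; ring.
  have : k%:R <= n%:R :> R by rewrite ler_nat.
  by move=> kn'; rewrite [leLHS]mulrC; apply: ler_pM => //; lra.
have four : (4 : R) <= 2 ^+ n.
  by rewrite (_ : 4 = 2 ^+ 2 :> R) ?ler_eXn2l// ?ltr1n// -natrX.
have two : - (2 : R) <= (-1) ^+ (n - k) * 2.
  by rewrite -signr_odd; case: odd; rewrite ?expr0 ?expr1; lra.
by rewrite mulrDr; lra.
Qed.

Lemma trpoly_roots n : (2 <= n)%N -> exists r : 'I_n -> R,
  injective r /\ forall k, root (intr_poly (trpoly n)) (r k).
Proof.
move=> n2; pose F := intr_poly (trpoly n); pose a (k : nat) : R := 4 * k%:R - 2.
have nroot k : (k <= n)%N -> F.[a k] != 0.
  by move=> kn; apply: contraTneq (trpoly_sign n2 kn) => ->; rewrite mulr0 ltxx.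
have amono k l : (k <= l)%N -> a k <= a l.
  by move=> kl; rewrite /a lerB// ler_pM2l// ler_nat.
have /choice[r rP] (k : 'I_n) : exists x, a k <= x <= a k.+1 /\ root F x.
  have kn := ltn_ord k.
  have [||x xa xr] := @poly_ivt _ ((-1) ^+ (n - k.+1) *: F) (a k) (a k.+1).
  - exact: amono.
  - rewrite !hornerZ (ltW (trpoly_sign n2 kn)) andbT.
    have := trpoly_sign n2 (ltnW kn); rewrite -(subnSK kn) exprS.
    by rewrite -/F -/(a k); lra.
  exists x; split => //; move: xr; rewrite !rootE hornerZ mulf_eq0 signr_eq0.
  by [].
exists r; split => [k l rkl|k]; last by case: (rP k).
have lt (i j : 'I_n) : (i < j)%N -> r i != r j.
  move=> ij; apply/eqP => rij; have [/andP[_ ri] _] := rP i.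
  have [/andP[rj _] /rootP rj0] := rP j.
  have /eqP : r j = a i.+1.
    by apply/eqP; rewrite eq_le -{1}rij ri (le_trans _ rj)// amono.
  by move=> /eqP rja; have := nroot i.+1 (ltn_ord i); rewrite -rja rj0 eqxx.
apply/eqP; case: (ltngtP k l) => [/lt|/lt|/val_inj->//]; first by rewrite rkl eqxx.
by rewrite rkl eqxx.
Qed.

End TotallyReal.

Section Norm.
Context {R : realType}.
Notation intr_poly := (map_poly (intr : int -> R)).
Notation intr_mx := (map_mx (intr : int -> R)).

(** The product is the norm of Y in Z[x] / (f), the determinant of the
    multiplication by Y modulo f; the Vandermonde matrix of the roots diagonalizes
    this multiplication. *)
Lemma norm_integral n (f Y : {poly int}) (r : 'I_n -> R) :
  f \is monic -> size f = n.+1 -> injective r ->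
  (forall k, root (intr_poly f) (r k)) ->
  exists N : int, \prod_k (intr_poly Y).[r k] = N%:~R.
Proof.
move=> fm sf rinj rf.
pose rem i := Pdiv.CommonRing.rmodp ('X^i * Y) f.
have srem i : (size (rem i) <= n)%N.
  by rewrite -ltnS -sf Pdiv.CommonRing.ltn_rmodpN0// monic_neq0.
pose M : 'M[int]_n := \matrix_(i, j) (rem i)`_j.
pose V : 'M[R]_n := Vandermonde n (\row_k r k).
have V0 : \det V != 0.
  rewrite det_Vandermonde; apply/prodf_neq0 => i _; apply/prodf_neq0 => j ij.
  by rewrite !mxE subr_eq0; apply: contraTneq ij => /rinj ->; rewrite ltnn.
exists (\det M); apply: (mulIf V0); rewrite -det_map_mx -det_mulmx.
have -> : intr_mx M *m V = V *m diag_mx (\row_k (intr_poly Y).[r k]).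
  apply/matrixP => i k; rewrite mul_mx_diag !mxE.
  transitivity (intr_poly (rem i)).[r k].
    rewrite (@horner_coef_wide _ n) ?(leq_trans (size_poly _ _))//.
    by apply: eq_bigr => j _; rewrite !mxE coef_map.
  have := congr1 (fun p => (intr_poly p).[r k]) (Pdiv.RingMonic.rdivp_eq fm ('X^i * Y)).
  rewrite !rmorphD !rmorphM/= map_polyXn hornerD !hornerM hornerXn.
  by rewrite (rootP (rf k)) mulr0 add0r => ->.
by rewrite det_mulmx det_diag mulrC; congr (_ * _); apply: eq_bigr => k _; rewrite mxE.
Qed.

Lemma irreducible_root_neq0 (f Y : {poly int}) (x : R) :
  irreducible_poly f -> Y != 0 -> (size Y < size f)%N ->
  root (intr_poly f) x -> (intr_poly Y).[x] != 0.
Proof.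
move=> fi Y0 sY fx.
pose Q p : {poly rat} := map_poly (intr : int -> rat) p.
have QR (p : {poly int}) : map_poly ratr (Q p) = intr_poly p :> {poly R}.
  by rewrite -map_poly_comp; apply: eq_map_poly => z /=; rewrite ratr_int.
have cop : coprimep (Q f) (Q Y).
  rewrite irreducible_poly_coprime; last exact/irreducible_rat_int.
  have sQ p : size (Q p) = size p.
    by rewrite size_map_inj_poly//; exact: intr_inj.
  apply: contraTN sY => /dvdp_leq; rewrite -leqNgt !sQ; apply.
  by rewrite -size_poly_eq0 sQ size_poly_eq0.
rewrite -(coprimep_map (ratr : {rmorphism rat -> R})) !QR in cop.
exact: coprimep_root cop fx.
Qed.

(** The linear forms are the conjugates of x_0 + x_1 alpha + ... over the totally
    real field of degree n generated by a root alpha of the polynomial above; a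
    dual basis w expresses their independence. *)
Lemma totally_real_forms n : (2 <= n)%N -> exists v : 'I_n -> 'cV[R]_n,
  (exists w : 'I_n -> 'cV[R]_n, forall i j, dot (v i) (w j) = (i == j)%:R) /\
  forall y : 'cV[int]_n, y != 0 ->
    (forall k, dot (v k) (intr_mx y) != 0) /\
    1 <= \prod_k `|dot (v k) (intr_mx y)|.
Proof.
move=> n2; have n0 : (0 < n)%N by apply: leq_trans n2.
have [r [rinj rf]] := @trpoly_roots R n n2.
pose V : 'M[R]_n := Vandermonde n (\row_k r k).
have Vu : V \in unitmx.
  rewrite unitmxE unitfE det_Vandermonde; apply/prodf_neq0 => i _.
  apply/prodf_neq0 => j ij; rewrite !mxE subr_eq0.
  by apply: contraTneq ij => /rinj ->; rewrite ltnn.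
exists (fun k => col k V); split.
  exists (fun k => col k (invmx V^T)) => i j.
  have := congr1 (fun M : 'M[R]_n => M i j) (mulmxV (_ : V^T \in unitmx)).
  rewrite unitmx_tr Vu => /(_ isT); rewrite !mxE => <-.
  by apply: eq_bigr => k _; rewrite !mxE.
move=> y y0; pose Y : {poly int} := rVpoly y^T.
have Yc (i : 'I_n) : Y`_i = y i 0 by rewrite coef_rVpoly_ord mxE.
have sY : (size Y <= n)%N by exact: size_poly.
have Y0 : Y != 0.
  by apply: contraNneq y0 => Y0; apply/eqP/colP => i; rewrite -Yc Y0 coef0 mxE.
have YE k : dot (col k V) (intr_mx y) = (intr_poly Y).[r k].
  rewrite (@horner_coef_wide _ n) ?(leq_trans (size_poly _ _))//.
  by apply: eq_bigr => i _; rewrite !mxE coef_map Yc mulrC.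
have ne0 k : dot (col k V) (intr_mx y) != 0.
  rewrite YE (irreducible_root_neq0 (trpoly_irreducible n0))//.
  by rewrite trpoly_size.
split => //; rewrite -normr_prod; under eq_bigr do rewrite YE.
have [N NE] := norm_integral Y (trpoly_monic n0) (trpoly_size n0) rinj rf.
have : \prod_k dot (col k V) (intr_mx y) != 0 by apply/prodf_neq0.
under eq_bigr do rewrite YE; rewrite NE intr_eq0 => N0.
by rewrite -intr_norm -[1]/(1%:~R) ler_int -gtz0_ge1 normr_gt0.
Qed.

End Norm.

(** * Upper bound *)

Section UpperBound.
Context {R : realType}.
Notation intr_mx := (map_mx (intr : int -> R)).

(** A is the common kernel of m of the conjugate linear forms. A short integer
    vector of B is within psi_d(A, B) times its length of A, so these m forms are
    small at it, whereas the product of all the forms is at least 1. This bounds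
    psi_d(A, B) from below; the inequality is raised to the power d because it is
    the d-th power of the length that the height controls. *)
Lemma exists_badly_approximable d m : (0 < d)%N -> (0 < m)%N ->
  exists A : {vspace 'cV[R]_(d + m)}, irrational_subspaces d d d A /\
  exists2 K : R, 0 < K & forall B, rational_subspaces d B ->
    1 <= K * height B ^+ (d + m) * psi d A B ^+ (m * d).
Proof.
move=> d0 m0; have n2 : (2 <= d + m)%N by lia.
have [v [[w vw] vint]] := @totally_real_forms R _ n2.
pose W : 'M[R]_(d + m, d) := \matrix_(i, j) w (lshift m j) i 0.
pose A := colspan W.
have Wx x : W *m x = \sum_j x j 0 *: w (lshift m j).
  rewrite mulmx_colE; apply: eq_bigr => j _; congr (_ *: _).
  by apply/colP => i; rewrite !mxE.
have dA : \dim A = d.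
  apply: dim_colspan => x; rewrite Wx => x0; apply/colP => i.
  have := congr1 (dot (v (lshift m i))) x0; rewrite dot0 dot_sumr (bigD1 i)//= big1.
    by rewrite dotZr vw eqxx mulr1 addr0 => ->; rewrite mxE.
  by move=> j ji; rewrite dotZr vw (inj_eq (@lshift_inj _ _)) eq_sym (negPf ji) mulr0.
have vA X k : X \in A -> dot (v (rshift d k)) X = 0.
  move=> /colspanP[x ->]; rewrite Wx dot_sumr big1// => j _.
  by rewrite dotZr vw eq_rlshift mulr0.
exists A; split.
  split => // B rB; rewrite ltnNge; apply/negP => le.
  have [y [t [y0 yB _ _]]] := short_vector d0 rB.
  have dB : \dim B = d by case: rB.
  have AB : (A :&: B)%VS = B.
    by apply/eqP; rewrite eqEdim capvSr dB.
  have [/(_ (rshift d (Ordinal m0)))/negP + _] := vint y y0; apply.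
  by rewrite vA// (subvP (capvSl A B))// AB.
pose n := (d + m)%N; pose L := 1 + \sum_k enorm (v k); pose c : R := (n * d)%:R.
have L1 : 1 <= L by rewrite lerDl sumr_ge0// => k _; rewrite enormE sqrtr_ge0.
have L0 : 0 < L := lt_le_trans ltr01 L1.
have vL k Z : `|dot (v k) Z| <= L * enorm Z.
  apply: (@le_trans _ _ (enorm (v k) * enorm Z)).
    rewrite !enormE -sqrtrM ?dot_ge0// -sqrtr_sqr ler_sqrt ?mulr_ge0 ?dot_ge0//.
    exact: dot_CauchySchwarz.
  rewrite ler_wpM2r ?enormE ?sqrtr_ge0// /L (bigD1 k)//= -enormE addrCA lerDl.
  by rewrite addr_ge0// sumr_ge0// => ? _; rewrite enormE sqrtr_ge0.
have c0 : 0 < c by rewrite ltr0n muln_gt0 d0 andbT addn_gt0 d0.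
exists (((L * c) ^+ n) ^+ d); first by rewrite !exprn_gt0// mulr_gt0.
move=> B rB; have dB : \dim B = d by case: rB.
have [y [t [y0 yB tH yt]]] := short_vector d0 rB.
have [_ y1] := vint y y0; set Y := intr_mx y in yB y1.
have eY : enorm Y <= c * t%:R.
  rewrite -[leRHS]ger0_norm ?mulr_ge0// -sqrtr_sqr enormE ler_wsqrtr//.
  apply: (@le_trans _ _ (\sum_(i < n) (d%:R * t%:R) ^+ 2)).
    apply: ler_sum => i _; rewrite -expr2 -real_normK ?num_real//.
    rewrite ler_sqr ?nnegrE ?mulr_ge0//.
    by rewrite mxE -intr_norm -natr_absz -natrM ler_nat.
  rewrite sumr_const card_ord -[leLHS]mulr_natl /c natrM -!mulrA [leRHS]exprMn.
  rewrite ler_wpM2r ?sqr_ge0//.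
  by rewrite -natrX ler_nat /n; case: (d + m)%N => // k; rewrite leq_pmulr.
have [X XA YX] := dist_le_psi d0 dA dB yB.
have p0 := psi_ge0 d A B; set p := psi d A B in p0 YX *.
have eYX : enorm (Y - X) <= p * enorm Y.
  by rewrite !enormE -{1}(ger0_norm p0) -sqrtr_sqr -sqrtrM ?sqr_ge0// ler_wsqrtr.
have e0 : 0 <= enorm Y by rewrite enormE sqrtr_ge0.
have prod : 1 <= (L * c * t%:R) ^+ n * p ^+ m.
  apply: le_trans y1 _; rewrite big_split_ord/= /n exprD -mulrA -exprMn.
  apply: ler_pM; rewrite ?prodr_ge0//.
    rewrite -[X in _ ^+ X]card_ord -prodr_const ler_prod// => i _; rewrite normr_ge0/=.
    by rewrite (le_trans (vL _ _))// -mulrA ler_wpM2l// ltW.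
  rewrite -[X in _ ^+ X]card_ord -prodr_const ler_prod// => i _; rewrite normr_ge0/=.
  have -> : dot (v (rshift d i)) Y = dot (v (rshift d i)) (Y - X).
    by rewrite dotDr dotNr (vA X)// subr0.
  rewrite (le_trans (vL _ _))// -!mulrA ler_wpM2l ?(ltW L0)// (le_trans eYX)//.
  by rewrite mulrC mulrA ler_wpM2r.
have : 1 <= ((L * c * t%:R) ^+ n * p ^+ m) ^+ d by rewrite exprn_ege1.
move/le_trans; apply; rewrite exprMn -!exprM ler_wpM2r ?exprn_ge0//.
rewrite exprMn ler_wpM2l ?exprn_ge0 ?mulr_ge0 ?(ltW L0) ?(ltW c0)//.
by rewrite mulnC exprM lerXn2r// nnegrE ?exprn_ge0// (le_trans _ tH)// exprn_ge0.
Qed.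

Lemma exists_mu_le d m : (0 < d)%N -> (0 < m)%N ->
  exists2 A : {vspace 'cV[R]_(d + m)}, irrational_subspaces d d d A &
    (mu A d d <= ((d%:R : R)^-1 + m%:R^-1)%:E)%E.
Proof.
move=> d0 m0; have [A [irr [K K0 HK]]] := exists_badly_approximable d0 m0.
exists A => //; apply: ge_ereal_sup => _ [b [b0 inf] <-]; rewrite lee_fin leNgt.
apply/negP => bgt; apply: inf.
have d0' : 0 < d%:R :> R by rewrite ltr0n.
have m0' : 0 < m%:R :> R by rewrite ltr0n.
(* With psi <= H^(-b), the badly approximable inequality reads H^g <= K. *)
pose g := b * (m * d)%:R - (d + m)%:R.
have g0 : 0 < g.
  rewrite subr_gt0 -ltr_pdivrMr ?ltr0n ?muln_gt0 ?m0//.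
  rewrite (_ : _ / _ = d%:R^-1 + m%:R^-1)//.
  by rewrite natrD natrM; field; rewrite !gt_eqF.
apply: sub_finite_set (finite_height_le d (K `^ g^-1)) => B [rB pB]; split => //.
have H0 := height_gt0 rB; set H := height B in H0 pB *.
have Hg : H `^ g <= K.
  have : 1 <= K * H ^+ (d + m) * (H `^ (- b)) ^+ (m * d).
    apply: le_trans (HK B rB) _.
    rewrite ler_wpM2l ?mulr_ge0 ?exprn_ge0 ?(ltW K0) ?(ltW H0)//.
    by rewrite lerXn2r ?nnegrE ?psi_ge0 ?powR_ge0.
  rewrite -!powR_mulrn ?powR_ge0 ?(ltW H0)// -powRrM -mulrA -powRD; last first.
    by rewrite (gt_eqF H0) implybT.
  rewrite (_ : _ + _ = - g); last by rewrite /g; ring.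
  by rewrite powRN -ler_pdivrMr ?invr_gt0 ?powR_gt0// invrK mul1r.
rewrite -[leLHS](powRr1 (ltW H0)) -(mulfV (lt0r_neq0 g0)) powRrM.
by apply: ge0_ler_powR; rewrite ?nnegrE ?powR_ge0 ?invr_ge0 ?(ltW g0) ?(ltW K0).
Qed.

End UpperBound.

Theorem mainTheorem6 (R : realType) (d : nat) (hd : (1 <= d)%N) :
  mu_ring R n d d d
    @[n --> within [set n : nat | (maxn (2 * d) 4 <= n)%N] \oo]
    --> ((d%:R : R)^-1)%:E.
Proof.
apply: (@squeeze_cvge _ _ _ _ (fun=> (d%:R^-1)%:E) _
  (fun n => (d%:R^-1 + (n - d)%:R^-1)%:E)).
- rewrite near_withinE; near=> n => /=; rewrite geq_max => /andP[dn n4].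
  apply/andP; split.
    by apply/ereal_infP => _ [A irr <-]; exact: mu_ge_inv.
  have nd : (0 < n - d)%N by rewrite subn_gt0; lia.
  have {1}-> : n = (d + (n - d))%N by lia.
  have [A irr muA] := @exists_mu_le R _ _ hd nd.
  by apply: le_trans muA; apply: ereal_inf_lbound; exists A.
- exact: cvg_cst.
- apply: (cvg_trans (cvg_app _ (cvg_within _))).
  apply: cvg_EFin; first by near=> n.
  rewrite -[X in _ --> X]addr0; apply: cvgD; first exact: cvg_cst.
  rewrite (cvg_centern d (fun n => n%:R^-1 : R)) -cvg_shiftS.
  exact: cvg_harmonic.
Unshelve. all: by end_near. Qed.
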